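(* Assume one of the following two cases. Case 1: $\mathsf f:[1,\infty)\to(0,\infty)$ is strictly increasing and smoothly varying with $\operatorname{Ind}\mathsf f\in(\frac12,1)$. Set $\mathsf g(x)=x/\mathsf f^{-1}(x)$ for $x\in[\mathsf f(1),\infty)$. Case 2: $\mathsf f(r)=r^{1/2}\int_1^rv(s)\,ds$ for $r\ge1$, where $v$ is smoothly varying with index $-1$ and $\int_1^\infty v(s)\,ds=\infty$. Set $\mathsf h(r)=\int_1^rs^{1/2}v(s)\,ds$ and $\mathsf g(x)=x/\mathsf h^{-1}(x)$ for $x\in[1,\infty)$. In both cases there exists $\hat x>0$ such that $\mathsf g$ is strictly decreasing on $[\hat x,\infty)$. Let $b=\mathsf g(\hat x)$, let $\varphi(t)=\mathsf g^{-1}(t)$ for $t\in(0,b]$ (the inverse of $\mathsf g|_{[\hat x,\infty)}$), and let $H(t)=\xi_{\varphi(t)}\xi_{\varphi(t)}^T$. Then, for large $r$, \[ \log\Bigl(\max_{|z|=r}\|W_H(b;z)\|\Bigr)\asymp\log|w_{H,22}(b;ir)|\asymp\mathsf f(r). \]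
   Context: Smooth variation: a positive $C^\infty$ function $f$ on $[1,\infty)$ is smoothly varying with index $\alpha$ if $h(x)=\log f(e^x)$ satisfies $h'(x)\to\alpha$ and $h^{(n)}(x)\to0$ for all $n\ge2$ as $x\to\infty$. $\operatorname{Ind}$ denotes the index. Notation: $\xi_\phi=(\cos\phi,\sin\phi)^T$. With $J=\begin{pmatrix}0&-1\\1&0\end{pmatrix}$, the fundamental solution $W_H(t;z)=(w_{H,ij}(t;z))$ of the Hamiltonian $H$ on $(0,b]$ solves $\partial_tW_H(t;z)J=zW_H(t;z)H(t)$ with $W_H(0;z)=I$. $W_H(b;\cdot)$ is the monodromy matrix. Asymptotic notation: $f\asymp g$ means $C_1g\le f\le C_2g$ for constants $C_1,C_2>0$. *)

(* Defs.v *)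
From HB Require Import structures.
From mathcomp Require Import all_boot all_order all_algebra.
From mathcomp Require Import all_classical all_reals all_analysis.
From mathcomp Require Import complex.

Set Implicit Arguments.
Unset Strict Implicit.
Unset Printing Implicit Defensive.

Import Order.TTheory GRing.Theory Num.Theory.
Import numFieldNormedType.Exports.

Local Open Scope classical_set_scope.
Local Open Scope ring_scope.

Section Defs.
Variable R : realType.

Definition smoothly_varying (f : R -> R) (a : R) : Prop :=
  (forall x, 1 <= x -> 0 < f x) /\
  {within [set x | 1 <= x], continuous f} /\
  (forall (n : nat) (x : R), 0 < x ->
      derivable (derive1n n (fun y => ln (f (expR y)))) x 1) /\
  (derive1 (fun y => ln (f (expR y))) x @[x --> +oo] --> a) /\
  (forall n : nat, (2 <= n)%N ->
      derive1n n (fun y => ln (f (expR y))) x @[x --> +oo] --> (0 : R)).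

Definition int1 (v : R -> R) (r : R) : R :=
  \int[@lebesgue_measure R]_(s in [set s | 1 <= s <= r]) v s.

Definition xi (phi : R) : 'cV[R]_2 :=
  \col_(i < 2) (if i == ord0 then cos phi else sin phi).

Definition Hmat (phi : R -> R) (t : R) : 'M[R[i]]_2 :=
  map_mx (fun x : R => (x%:C)%C) (xi (phi t) *m (xi (phi t))^T).

Definition Jmat : 'M[R[i]]_2 :=
  \matrix_(i < 2, j < 2)
    (if (i == ord0) && (j == ord_max) then -1
     else if (i == ord_max) && (j == ord0) then 1 else 0).

Definition cderiv (F : R -> R[i]) (t : R) (d : R[i]) : Prop :=
  is_derive t 1 (fun s => complex.Re (F s)) (complex.Re d) /\
  is_derive t 1 (fun s => complex.Im (F s)) (complex.Im d).

Definition ccont_on (F : R -> R[i]) (A : set R) : Prop :=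
  {within A, continuous (fun s => complex.Re (F s))} /\
  {within A, continuous (fun s => complex.Im (F s))}.

Definition fundamental_solution (Hc : R -> 'M[R[i]]_2) (b : R)
    (W : R -> R[i] -> 'M[R[i]]_2) : Prop :=
  forall z : R[i],
    W 0 z = 1 /\
    (forall i j : 'I_2, ccont_on (fun t => W t z i j) [set t | 0 <= t <= b]) /\
    (forall t, 0 < t < b ->
       exists D : 'M[R[i]]_2,
         (forall i j : 'I_2, cderiv (fun s => W s z i j) t (D i j)) /\
         D *m Jmat = z *: (W t z *m Hc t)).

Definition cabs (x : R[i]) : R :=
  Num.sqrt (complex.Re x ^+ 2 + complex.Im x ^+ 2).

Definition vnorm (v : 'cV[R[i]]_2) : R :=
  Num.sqrt (cabs (v ord0 ord0) ^+ 2 + cabs (v ord_max ord0) ^+ 2).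

Definition opnorm (A : 'M[R[i]]_2) : R :=
  sup [set vnorm (A *m v) | v in [set v | vnorm v = 1]].

Definition Mmax (W : R -> R[i] -> 'M[R[i]]_2) (b r : R) : R :=
  sup [set opnorm (W b z) | z in [set z : R[i] | cabs z = r]].

Definition asymp_large (A B : R -> R) : Prop :=
  exists C1 C2 r0 : R, 0 < C1 /\ 0 < C2 /\
    forall r, r0 <= r -> C1 * B r <= A r /\ A r <= C2 * B r.

End Defs.

(* Main.v *)
(** Parametrise the time axis by [s = finv x]: then [phi = X s] with [X = f]
    (case 1) or [X = h] (case 2), [t = tau s = X s / s], and in both cases
    [f r = sqrt r * V r] with [V' s] comparable to [X s / s^(3/2)]. Write a row
    [w] of the fundamental solution in the rotating frame, [P = w . xi_phi] and
    [Q = w . xi_phi^perp]; the system becomes [P' = X' Q],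
    [Q' = (z tau' - X') P].

    Upper bound: on [s <= r] the weighted norm [r |P|^2 + s |Q|^2] grows, as
    [s] decreases, at rate at most [sqrt r * V' s]; the times before [tau r]
    contribute [r * tau r = X r] by the trivial estimate, and the remaining
    bounded range of [s] contributes [O(sqrt r)].

    Lower bound, [z = i r]: with [E = Im (Q conj P) >= 0] and
    [G = Re (Q conj P)], the function [2 E - G] grows at rate at least a constant
    times [sqrt r * V' s] on [s <= (1 - a2) r]. This forces the second row of
    the monodromy matrix to be large, and [|w_21|^2 <= r^2 exp b |w_22|^2]
    transfers the growth to [w_22]. *)

Require Import Defs.
From HB Require Import structures.
From mathcomp Require Import all_boot all_order all_algebra.
From mathcomp Require Import all_classical all_reals all_analysis.
From mathcomp Require Import complex ring lra.

Set Implicit Arguments.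
Unset Strict Implicit.
Unset Printing Implicit Defensive.

Import Order.TTheory GRing.Theory Num.Theory.
Import numFieldNormedType.Exports.

Local Open Scope classical_set_scope.
Local Open Scope ring_scope.

(** * Derivative rules, monotonicity, Gronwall inequalities and clamping on the real line *)

Section Calculus.
Context {R : realType}.
Implicit Types (f g : R -> R) (x : R).

(** In the rotating frame $P$ feeds $Q$ with strength $r|\tau'|$ and $Q$ feeds $P$ with strength
    $X'$. The rotation preserves the unweighted norm, whose rate $r|\tau'|$ integrates to an
    exponent linear in $r$, far above $f(r)$. The weights $r$ and $s$ replace this rate by the
    geometric mean of the two strengths: since $X'\asymp X/s$ and $|\tau'|\asymp X/s^2$, it is of
    order $\sqrt r\,X/s^{3/2}$, whose integral up to $r$ is of order $f(r)$. All this rests on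
    $a_1X\le sX'\le a_2X$ with $a_1>0$ and $a_2<1$; the upper bound also makes $\tau$ decrease to
    zero. For the lower bound the growing form must gain from both components. $E$ gains from
    $|P|^2$ only; $-G$ adds a gain from $|Q|^2$ and a loss in $|P|^2$, and $2E$ covers that loss as
    long as $X'\le r|\tau'|$. This is the origin of the restriction $s\le(1-a_2)r$. The form may be
    negative at the start, so a stretch on which $X$ increases by at least 1 is spent on making it
    positive. *)

Lemma is_derive_addf f g x df dg : is_derive x 1 f df -> is_derive x 1 g dg ->
  is_derive x 1 (fun y => f y + g y) (df + dg).
Proof. exact: is_deriveD. Qed.

Lemma is_derive_oppf f x df : is_derive x 1 f df ->
  is_derive x 1 (fun y => - f y) (- df).
Proof. exact: is_deriveN. Qed.

Lemma is_derive_mulf f g x df dg : is_derive x 1 f df -> is_derive x 1 g dg ->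
  is_derive x 1 (fun y => f y * g y) (df * g x + f x * dg).
Proof.
move=> fd gd; apply: (is_derive_eq (is_deriveM fd gd)).
by rewrite /GRing.scale /= addrC [g x * _]mulrC.
Qed.

Lemma is_derive_cstf (c x : R) : is_derive x 1 (fun _ : R => c) 0.
Proof. exact: is_derive_cst. Qed.

Lemma is_derive_idf x : is_derive x 1 (fun y : R => y) 1.
Proof. exact: is_derive_id. Qed.

Lemma is_derive_compf f g x a b :
  is_derive (g x) 1 f a -> is_derive x 1 g b ->
  is_derive x 1 (fun y => f (g y)) (a * b).
Proof. exact: is_derive1_comp. Qed.

Lemma is_derive_invf f x df : f x != 0 -> is_derive x 1 f df ->
  is_derive x 1 (fun y => (f y)^-1) (- (df / (f x) ^+ 2)).
Proof.
move=> f0 fd; apply: (is_derive_eq (is_deriveV f0 fd)).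
by rewrite /GRing.scale /= mulNr mulrC.
Qed.

Lemma continuous_addf f g : continuous f -> continuous g ->
  continuous (fun y => f y + g y).
Proof. by move=> fc gc x; apply: cvgD; [exact: fc|exact: gc]. Qed.

Lemma continuous_oppf f : continuous f -> continuous (fun y => - f y).
Proof. by move=> fc x; apply: cvgN; exact: fc. Qed.

Lemma continuous_mulf f g : continuous f -> continuous g ->
  continuous (fun y => f y * g y).
Proof. by move=> fc gc x; apply: cvgM; [exact: fc|exact: gc]. Qed.

Lemma continuous_cstf (c : R) : continuous (fun _ : R => c).
Proof. by move=> x; exact: cvg_cst. Qed.

Lemma continuous_idf : continuous (fun y : R => y).
Proof. by move=> x. Qed.

Lemma continuous_compf f g : continuous f -> continuous g ->
  continuous (fun y => f (g y)).
Proof. by move=> fc gc x; apply: continuous_comp; [exact: gc|exact: fc]. Qed.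

Lemma continuous_invf f : continuous f -> (forall x, f x != 0) ->
  continuous (fun y => (f y)^-1).
Proof. by move=> fc f0 x; apply: cvgV => //; exact: fc. Qed.

Lemma continuous_max_cst (c : R) : continuous (fun y : R => Num.max c y).
Proof.
move=> x; apply: (@continuous_max _ _ (fun=> c) id); first exact: cvg_cst.
exact: cvg_id.
Qed.

Lemma derive_le0_nincr (F dF : R -> R) (a b : R) : a <= b -> continuous F ->
  (forall x, a < x < b -> is_derive x 1 F (dF x)) ->
  (forall x, a < x < b -> dF x <= 0) -> F b <= F a.
Proof.
rewrite le_eqVlt => /orP[/eqP->//|ab] cF dFx dF0.
have dFx' x : x \in `]a, b[ -> is_derive x 1 F (dF x).
  by rewrite in_itv; exact: dFx.
have [c cab e] := MVT ab dFx' (continuous_subspaceT cF).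
rewrite -subr_le0 e; apply: mulr_le0_ge0; last by rewrite subr_ge0 ltW.
by apply: dF0; rewrite in_itv in cab.
Qed.

Lemma derive_ge0_ndecr (F dF : R -> R) (a b : R) : a <= b -> continuous F ->
  (forall x, a < x < b -> is_derive x 1 F (dF x)) ->
  (forall x, a < x < b -> 0 <= dF x) -> F a <= F b.
Proof.
move=> ab cF dFx dF0; rewrite -lerN2.
apply: (@derive_le0_nincr (fun x => - F x) (fun x => - dF x)) => //.
- exact: continuous_oppf.
- by move=> x /dFx; exact: is_derive_oppf.
- by move=> x /dF0; rewrite oppr_le0.
Qed.

Lemma derive_gt0_incr (F dF : R -> R) (a b : R) : a < b -> continuous F ->
  (forall x, a < x < b -> is_derive x 1 F (dF x)) ->
  (forall x, a < x < b -> 0 < dF x) -> F a < F b.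
Proof.
move=> ab cF dFx dF0.
have dFx' x : x \in `]a, b[ -> is_derive x 1 F (dF x).
  by rewrite in_itv; exact: dFx.
have [c cab e] := MVT ab dFx' (continuous_subspaceT cF).
rewrite -subr_gt0 e; apply: mulr_gt0; last by rewrite subr_gt0.
by apply: dF0; rewrite in_itv in cab.
Qed.

(** The integrating factor makes $Ne^{-\rho}$ nonincreasing. [N] and [rho] may have any sign, which
    allows the reversed version below and decreasing [rho]. *)
Lemma gronwall (N dN rho drho : R -> R) (a b : R) : a <= b ->
  continuous N -> continuous rho ->
  (forall x, a < x < b -> is_derive x 1 N (dN x)) ->
  (forall x, a < x < b -> is_derive x 1 rho (drho x)) ->
  (forall x, a < x < b -> dN x <= drho x * N x) ->
  N b <= N a * expR (rho b - rho a).
Proof.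
move=> ab cN cr dNx drx le.
suff : N b * expR (- rho b) <= N a * expR (- rho a).
  move=> /(ler_wpM2r (expR_ge0 (rho b))).
  by rewrite -!mulrA -!expRD addNr expR0 mulr1 addrC.
apply: (@derive_le0_nincr (fun x => N x * expR (- rho x))
  (fun x => dN x * expR (- rho x) + N x * (expR (- rho x) * - drho x))) => //.
- apply: continuous_mulf => //; apply: continuous_compf.
    exact: continuous_expR.
  exact: continuous_oppf.
- move=> x xab; apply: (is_derive_mulf (dNx _ xab)).
  exact: (is_derive_compf (is_derive_expR _) (is_derive_oppf (drx _ xab))).
- move=> x xab; rewrite [_ * - _]mulrC mulrA -mulrDl mulr_le0_ge0 ?expR_ge0//.
  by rewrite mulrN subr_le0 mulrC le.
Qed.

Lemma gronwall_rev (N dN rho drho : R -> R) (a b : R) : a <= b ->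
  continuous N -> continuous rho ->
  (forall x, a < x < b -> is_derive x 1 N (dN x)) ->
  (forall x, a < x < b -> is_derive x 1 rho (drho x)) ->
  (forall x, a < x < b -> - (drho x * N x) <= dN x) ->
  N a <= N b * expR (rho b - rho a).
Proof.
move=> ab cN cr dNx drx le.
have := @gronwall (fun x => - N x) (fun x => - dN x) (fun x => - rho x)
  (fun x => - drho x) a b ab.
rewrite mulNr lerN2 => H.
have {}H : N a * expR (- rho b - - rho a) <= N b.
  apply: H.
  - exact: continuous_oppf.
  - exact: continuous_oppf.
  - by move=> x /dNx; exact: is_derive_oppf.
  - by move=> x /drx; exact: is_derive_oppf.
  - by move=> x /le; rewrite mulrNN lerNl.
have := ler_wpM2r (expR_ge0 (rho b - rho a)) H.
rewrite -mulrA -expRD (_ : _ + _ = 0) ?expR0 ?mulr1//; ring.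
Qed.

Lemma locally_eq_is_derive f g x df a b : a < x < b ->
  (forall y, a < y < b -> f y = g y) ->
  is_derive x 1 f df -> is_derive x 1 g df.
Proof.
move=> /andP[ax xb] fg; apply: near_eq_is_derive.
near=> y; apply: fg; apply/andP; split.
- by near: y; exact: lt_nbhsr.
- by near: y; exact: lt_nbhsl.
Unshelve. all: end_near. Qed.

Lemma continuous_comp_within f g (A : set R) : {within A, continuous f} ->
  continuous g -> (forall y, A (g y)) -> continuous (fun y => f (g y)).
Proof.
move=> /subspace_continuousP fc gc Ag x.
apply: (cvg_trans _ (fc _ (Ag x))) => B wB.
have : nbhs x (g @^-1` [set y | A y -> B (f y)]) by exact: gc.
by apply: filterS => y /=; apply; exact: Ag.
Qed.

(** Freezing a function outside an interval makes it continuous on the whole line, so later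
    statements can ask for plain continuity. *)
Lemma clamp_continuous f (a b : R) : a <= b ->
  {within [set t | a <= t <= b], continuous f} ->
  continuous (fun t => f (Num.max a (Num.min t b))).
Proof.
move=> ab fc; apply: (continuous_comp_within fc).
  move=> y; apply: (@continuous_max _ _ (fun=> a) (fun t => Num.min t b)).
    exact: cvg_cst.
  by apply: (@continuous_min _ _ id (fun=> b)); [exact: cvg_id|exact: cvg_cst].
by move=> y /=; rewrite le_max lexx ge_max ab ge_min lexx orbT.
Qed.

Lemma clamp_continuousy f (a : R) : {within [set t | a <= t], continuous f} ->
  continuous (fun t => f (Num.max a t)).
Proof.
move=> fc; apply: (continuous_comp_within fc); first exact: continuous_max_cst.
by move=> y /=; rewrite le_max lexx.
Qed.

End Calculus.

(** Meant to follow [eapply is_derive_eq]: the shape of the function determines the derivative,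
    which [ring] then compares with the wanted one. *)
Ltac is_derive_tac :=
  repeat (first
    [ eassumption
    | apply: is_derive_addf | apply: is_derive_oppf | apply: is_derive_mulf
    | apply: is_derive_cstf | apply: is_derive_idf ]).
Ltac continuous_tac :=
  repeat (first
    [ apply: continuous_cstf | apply: continuous_idf
    | lazymatch goal with
      | |- continuous (fun x => (_ + _)%R) => apply: continuous_addf
      | |- continuous (fun x => (_ * _)%R) => apply: continuous_mulf
      | |- continuous (fun x => (- _)%R) => apply: continuous_oppf
      end
    | eassumption
    | apply: continuous_addf | apply: continuous_oppf | apply: continuous_mulf ]).

(** * One row of the system: rotating frame, quadratic forms and their derivatives *)

Section RowSystem.
Context {R : realType}.

(* The row [(u0 + i y0, u1 + i y1)] of a solution of [W' J = z W H] with
   [z = a + i c], written in real coordinates. *)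
Record row_solution (phi : R -> R) (b a c : R) (u0 u1 y0 y1 : R -> R) : Prop :=
 RowSolution {
  row_cu0 : continuous u0;
  row_cu1 : continuous u1;
  row_cy0 : continuous y0;
  row_cy1 : continuous y1;
  row_du0 : forall t, 0 < t < b -> is_derive t 1 u0
    (- ((a * (u0 t * cos (phi t) + u1 t * sin (phi t))
       - c * (y0 t * cos (phi t) + y1 t * sin (phi t))) * sin (phi t)));
  row_du1 : forall t, 0 < t < b -> is_derive t 1 u1
    ((a * (u0 t * cos (phi t) + u1 t * sin (phi t))
       - c * (y0 t * cos (phi t) + y1 t * sin (phi t))) * cos (phi t));
  row_dy0 : forall t, 0 < t < b -> is_derive t 1 y0
    (- ((a * (y0 t * cos (phi t) + y1 t * sin (phi t))
       + c * (u0 t * cos (phi t) + u1 t * sin (phi t))) * sin (phi t)));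
  row_dy1 : forall t, 0 < t < b -> is_derive t 1 y1
    ((a * (y0 t * cos (phi t) + y1 t * sin (phi t))
       + c * (u0 t * cos (phi t) + u1 t * sin (phi t))) * cos (phi t)) }.

(* [pr + i pi] and [qr + i qi] are the components of the row along [xi_phi] and
   its orthogonal, as functions of the parameter [s]. *)
Record rotated_solution (dX dtau : R -> R) (sh a c : R)
    (pr pi qr qi : R -> R) : Prop := RotatedSolution {
  rot_cpr : continuous pr;
  rot_cpi : continuous pi;
  rot_cqr : continuous qr;
  rot_cqi : continuous qi;
  rot_dpr : forall s, sh < s -> is_derive s 1 pr (dX s * qr s);
  rot_dpi : forall s, sh < s -> is_derive s 1 pi (dX s * qi s);
  rot_dqr : forall s, sh < s -> is_derive s 1 qr
    (dtau s * (a * pr s - c * pi s) - dX s * pr s);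
  rot_dqi : forall s, sh < s -> is_derive s 1 qi
    (dtau s * (a * pi s + c * pr s) - dX s * pi s) }.

(** The time derivative of the row is $zP\,\xi_\phi^\perp$, and the frame turns at speed $X'$. Hence
    $P$ changes through the rotation only, while $Q$ also receives $z\tau'P$. *)
Lemma rotate_row (phi X tau dX dtau : R -> R) (sh b a c : R)
    (u0 u1 y0 y1 : R -> R) :
  row_solution phi b a c u0 u1 y0 y1 ->
  continuous X -> continuous tau ->
  (forall s, sh < s -> is_derive s 1 X (dX s)) ->
  (forall s, sh < s -> is_derive s 1 tau (dtau s)) ->
  (forall s, sh < s -> 0 < tau s < b) ->
  (forall s, sh < s -> phi (tau s) = X s) ->
  rotated_solution dX dtau sh a c
    (fun s => u0 (tau s) * cos (X s) + u1 (tau s) * sin (X s))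
    (fun s => y0 (tau s) * cos (X s) + y1 (tau s) * sin (X s))
    (fun s => u1 (tau s) * cos (X s) - u0 (tau s) * sin (X s))
    (fun s => y1 (tau s) * cos (X s) - y0 (tau s) * sin (X s)).
Proof.
move=> [cu0 cu1 cy0 cy1 du0 du1 dy0 dy1] cX ct dXs dts tb pX.
have ccos : continuous (fun s => cos (X s)).
  exact: (continuous_compf (@continuous_cos R)).
have csin : continuous (fun s => sin (X s)).
  exact: (continuous_compf (@continuous_sin R)).
have cu0t := continuous_compf cu0 ct; have cu1t := continuous_compf cu1 ct.
have cy0t := continuous_compf cy0 ct; have cy1t := continuous_compf cy1 ct.
have dcos s : sh < s -> is_derive s 1 (fun s => cos (X s)) (- sin (X s) * dX s).
  by move=> h; exact: (is_derive_compf (is_derive_cos _) (dXs _ h)).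
have dsin s : sh < s -> is_derive s 1 (fun s => sin (X s)) (cos (X s) * dX s).
  by move=> h; exact: (is_derive_compf (is_derive_sin _) (dXs _ h)).
split.
- by continuous_tac.
- by continuous_tac.
- by continuous_tac.
- by continuous_tac.
- move=> s hs; have d0 := is_derive_compf (du0 _ (tb _ hs)) (dts _ hs).
  have d1 := is_derive_compf (du1 _ (tb _ hs)) (dts _ hs).
  have dc := dcos _ hs; have ds := dsin _ hs.
  eapply is_derive_eq; first is_derive_tac.
  rewrite /GRing.scale /= (pX _ hs); ring.
- move=> s hs; have d0 := is_derive_compf (dy0 _ (tb _ hs)) (dts _ hs).
  have d1 := is_derive_compf (dy1 _ (tb _ hs)) (dts _ hs).
  have dc := dcos _ hs; have ds := dsin _ hs.
  eapply is_derive_eq; first is_derive_tac.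
  rewrite /GRing.scale /= (pX _ hs); ring.
- move=> s hs; have d0 := is_derive_compf (du0 _ (tb _ hs)) (dts _ hs).
  have d1 := is_derive_compf (du1 _ (tb _ hs)) (dts _ hs).
  have dc := dcos _ hs; have ds := dsin _ hs.
  eapply is_derive_eq; first is_derive_tac.
  rewrite /GRing.scale /= (pX _ hs) -[X in dtau s * X]mulr1 -(cos2Dsin2 (X s)); ring.
- move=> s hs; have d0 := is_derive_compf (dy0 _ (tb _ hs)) (dts _ hs).
  have d1 := is_derive_compf (dy1 _ (tb _ hs)) (dts _ hs).
  have dc := dcos _ hs; have ds := dsin _ hs.
  eapply is_derive_eq; first is_derive_tac.
  rewrite /GRing.scale /= (pX _ hs) -[X in dtau s * X]mulr1 -(cos2Dsin2 (X s)); ring.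
Qed.

Lemma rotate_norm (u0 u1 y0 y1 th : R) :
  (u0 * cos th + u1 * sin th) ^+ 2 + (y0 * cos th + y1 * sin th) ^+ 2 +
  ((u1 * cos th - u0 * sin th) ^+ 2 + (y1 * cos th - y0 * sin th) ^+ 2) =
  u0 ^+ 2 + u1 ^+ 2 + (y0 ^+ 2 + y1 ^+ 2).
Proof.
rewrite -[RHS]mulr1 -(cos2Dsin2 th); ring.
Qed.

(** This is $2xy\sqrt{AB}\le x^2A+y^2B$, with the bound on [H] kept squared to avoid roots of [A]
    and [B]. For $x=\sqrt r$, $y=\sqrt s$ the right side is the weighted norm. *)
Lemma scaled_amgm (x y A B rho H : R) : 0 <= x -> 0 <= y -> 0 <= A -> 0 <= B ->
  0 <= rho -> H ^+ 2 <= rho ^+ 2 * (A * B) ->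
  2 * x * y * `|H| <= rho * (x ^+ 2 * A + y ^+ 2 * B).
Proof.
move=> x0 y0 A0 B0 r0 hH.
rewrite -(@ler_pXn2r _ 2) ?nnegrE//; last 2 first.
- by rewrite !mulr_ge0.
- by rewrite mulr_ge0// addr_ge0// mulr_ge0// sqr_ge0.
rewrite exprMn real_normK ?num_real//.
have xy0 : 0 <= (2 * x * y) ^+ 2 by exact: sqr_ge0.
apply: (le_trans (ler_wpM2l xy0 hH)).
rewrite -subr_ge0.
have -> : (rho * (x ^+ 2 * A + y ^+ 2 * B)) ^+ 2 - (2 * x * y) ^+ 2 * (rho ^+ 2 * (A * B))
  = (rho * (x ^+ 2 * A - y ^+ 2 * B)) ^+ 2 by ring.
exact: sqr_ge0.
Qed.

Lemma scaled_amgm_bounds (x y A B rho H : R) : 0 <= x -> 0 <= y -> 0 <= A ->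
  0 <= B -> 0 <= rho -> H ^+ 2 <= rho ^+ 2 * (A * B) ->
  - (rho * (x ^+ 2 * A + y ^+ 2 * B)) <= 2 * x * y * H /\
  2 * x * y * H <= rho * (x ^+ 2 * A + y ^+ 2 * B).
Proof.
move=> x0 y0 A0 B0 r0 hH; have le := scaled_amgm x0 y0 A0 B0 r0 hH.
have xy0 : 0 <= 2 * x * y by rewrite !mulr_ge0.
split.
  rewrite lerNl -mulrN; apply: le_trans le; apply: ler_wpM2l => //.
  by rewrite -normrN ler_norm.
by apply: le_trans le; apply: ler_wpM2l => //; exact: ler_norm.
Qed.

Section Forms.
Variables (pr pi qr qi : R).

(** The left side is $(\mathrm{Re}\,zP\overline Q)^2$ with $z=a+ic$, and the defect is the square of
    the imaginary part. The next two lemmas are the cases $z=1$ and $z=i$. *)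
Lemma hermitian_form_le (a c r : R) : a ^+ 2 + c ^+ 2 = r ^+ 2 ->
  ((a * pr - c * pi) * qr + (a * pi + c * pr) * qi) ^+ 2 <=
  r ^+ 2 * ((pr ^+ 2 + pi ^+ 2) * (qr ^+ 2 + qi ^+ 2)).
Proof.
move=> <-; rewrite -subr_ge0.
have -> : (a ^+ 2 + c ^+ 2) * ((pr ^+ 2 + pi ^+ 2) * (qr ^+ 2 + qi ^+ 2)) -
   ((a * pr - c * pi) * qr + (a * pi + c * pr) * qi) ^+ 2 =
   (a * (pr * qi - pi * qr) - c * (pr * qr + pi * qi)) ^+ 2 by ring.
exact: sqr_ge0.
Qed.

Lemma real_form_le :
  (pr * qr + pi * qi) ^+ 2 <=
  1 ^+ 2 * ((pr ^+ 2 + pi ^+ 2) * (qr ^+ 2 + qi ^+ 2)).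
Proof.
have -> : pr * qr + pi * qi = (1 * pr - 0 * pi) * qr + (1 * pi + 0 * pr) * qi.
  by ring.
by apply: hermitian_form_le; ring.
Qed.

Lemma imag_form_le :
  (pr * qi - pi * qr) ^+ 2 <=
  1 ^+ 2 * ((pr ^+ 2 + pi ^+ 2) * (qr ^+ 2 + qi ^+ 2)).
Proof.
have -> : pr * qi - pi * qr = (0 * pr - 1 * pi) * qr + (0 * pi + 1 * pr) * qi.
  by ring.
by apply: hermitian_form_le; ring.
Qed.

End Forms.

Section Phases.
Variables (dX dtau : R -> R) (sh a c : R) (pr pi qr qi : R -> R).
Hypothesis sol : rotated_solution dX dtau sh a c pr pi qr qi.

(** [A], [B], [G], [E], [H] are $|P|^2$, $|Q|^2$, $\mathrm{Re}(Q\overline P)$,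
    $\mathrm{Im}(Q\overline P)$ and $\mathrm{Re}(zP\overline Q)$. *)
Let A s := pr s ^+ 2 + pi s ^+ 2.
Let B s := qr s ^+ 2 + qi s ^+ 2.
Let G s := pr s * qr s + pi s * qi s.
Let E s := pr s * qi s - pi s * qr s.
Let H s := (a * pr s - c * pi s) * qr s + (a * pi s + c * pr s) * qi s.

Lemma rot_cA : continuous A.
Proof. case: sol => ? ? ? ? _ _ _ _; rewrite /A; continuous_tac. Qed.
Lemma rot_cB : continuous B.
Proof. case: sol => ? ? ? ? _ _ _ _; rewrite /B; continuous_tac. Qed.
Lemma rot_cG : continuous G.
Proof. case: sol => ? ? ? ? _ _ _ _; rewrite /G; continuous_tac. Qed.
Lemma rot_cE : continuous E.
Proof. case: sol => ? ? ? ? _ _ _ _; rewrite /E; continuous_tac. Qed.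

Lemma rot_dA s : sh < s -> is_derive s 1 A (2 * (dX s * G s)).
Proof.
case: sol => _ _ _ _ d1 d2 d3 d4 hs.
have := d1 _ hs; have := d2 _ hs; move=> ? ?.
eapply is_derive_eq; first is_derive_tac.
rewrite /GRing.scale /= /G; ring.
Qed.

Lemma rot_dB s : sh < s -> is_derive s 1 B (2 * (dtau s * H s - dX s * G s)).
Proof.
case: sol => _ _ _ _ d1 d2 d3 d4 hs.
have := d3 _ hs; have := d4 _ hs; move=> ? ?.
eapply is_derive_eq; first is_derive_tac.
rewrite /GRing.scale /= /G /H; ring.
Qed.

Lemma rot_dG s : sh < s -> is_derive s 1 G
  (dX s * (B s - A s) + dtau s * (a * A s)).
Proof.
case: sol => _ _ _ _ d1 d2 d3 d4 hs.
have := d1 _ hs; have := d2 _ hs; have := d3 _ hs; have := d4 _ hs.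
move=> ? ? ? ?.
eapply is_derive_eq; first is_derive_tac.
rewrite /GRing.scale /= /A /B; ring.
Qed.

(** The rotation preserves $\mathrm{Im}(Q\overline P)$, so only the $\tau'$ term survives. *)
Lemma rot_dE s : sh < s -> is_derive s 1 E (dtau s * (c * A s)).
Proof.
case: sol => _ _ _ _ d1 d2 d3 d4 hs.
have := d1 _ hs; have := d2 _ hs; have := d3 _ hs; have := d4 _ hs.
move=> ? ? ? ?.
eapply is_derive_eq; first is_derive_tac.
rewrite /GRing.scale /= /A; ring.
Qed.

End Phases.
End RowSystem.

(** * The trivial growth estimate in the time variable *)

Section RowGrowth.
Context {R : realType}.
Variables (phi : R -> R) (b a c r : R) (u0 u1 y0 y1 : R -> R).
Hypothesis sol : row_solution phi b a c u0 u1 y0 y1.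
Hypothesis r_ge0 : 0 <= r.
Hypothesis acr : a ^+ 2 + c ^+ 2 = r ^+ 2.

(** $\frac{d}{dt}|w|^2=2\,\mathrm{Re}(zP\overline Q)\le r|w|^2$ whatever [phi] is, hence also down
    to $t=0$, where the angle of the application blows up. *)
Lemma row_growth t : 0 <= t <= b ->
  u0 t ^+ 2 + u1 t ^+ 2 + (y0 t ^+ 2 + y1 t ^+ 2) <=
  (u0 0 ^+ 2 + u1 0 ^+ 2 + (y0 0 ^+ 2 + y1 0 ^+ 2)) * expR (r * t).
Proof.
move=> /andP[t0 tb].
rewrite -[r * t]subr0 -[X in _ - X](mulr0 r).
case: sol => cu0 cu1 cy0 cy1 du0 du1 dy0 dy1.
pose p s := u0 s * cos (phi s) + u1 s * sin (phi s).
pose q s := y0 s * cos (phi s) + y1 s * sin (phi s).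
pose dM s := 2 * ((a * p s - c * q s) * (u1 s * cos (phi s) - u0 s * sin (phi s))
  + (a * q s + c * p s) * (y1 s * cos (phi s) - y0 s * sin (phi s))).
apply: (@gronwall _ (fun s => u0 s ^+ 2 + u1 s ^+ 2 + (y0 s ^+ 2 + y1 s ^+ 2))
  dM (fun s => r * s) (fun=> r)) => //.
- by continuous_tac.
- by continuous_tac.
- move=> s /andP[s0 st]; have sb : 0 < s < b by rewrite s0 (lt_le_trans st).
  have := du0 _ sb; have := du1 _ sb; have := dy0 _ sb; have := dy1 _ sb.
  move=> ? ? ? ?.
  eapply is_derive_eq; first is_derive_tac.
  rewrite /GRing.scale /= /dM /p /q; ring.
- move=> s _.
  eapply is_derive_eq; first is_derive_tac.
  rewrite /GRing.scale /=; ring.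
- move=> s _; rewrite -(rotate_norm _ _ _ _ (phi s)) /dM.
  have h := @hermitian_form_le _ (p s) (q s) (u1 s * cos (phi s) - u0 s * sin (phi s))
    (y1 s * cos (phi s) - y0 s * sin (phi s)) _ _ _ acr.
  have := scaled_amgm_bounds ler01 ler01 _ _ r_ge0 h.
  rewrite !addr_ge0 ?sqr_ge0// => /(_ isT isT)[_].
  by rewrite expr1n !mul1r !mulr1.
Qed.

End RowGrowth.

(** * The estimates common to both cases, and the upper bound in the variable [s] *)

Section Chirp.
Context {R : realType}.

(* The two cases of the theorem seen through one set of estimates: [phi] takes
   the value [X s] at time [X s / s], and [Num.sqrt s * V s] is the growth
   function [f]. *)
Record chirp (X dX V dV : R -> R) (S a1 a2 c1 c2 C : R) : Prop := Chirp {
  chirp_S : 1 < S;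
  chirp_a1 : 0 < a1;
  chirp_a2 : a2 < 1;
  chirp_c1 : 0 < c1;
  chirp_cX : continuous X;
  chirp_cV : continuous V;
  chirp_X_ge0 : forall s : R, 1 <= s -> 0 <= X s;
  chirp_X_gt0 : forall s : R, 1 < s -> 0 < X s;
  chirp_dX : forall s : R, 1 < s -> is_derive s 1 X (dX s);
  chirp_dX_ge0 : forall s : R, 1 < s -> 0 <= dX s;
  chirp_dX_ge : forall s : R, S <= s -> a1 * (X s / s) <= dX s;
  chirp_dX_le : forall s : R, S <= s -> dX s <= a2 * (X s / s);
  chirp_dV : forall s : R, S <= s -> is_derive s 1 V (dV s);
  chirp_dV_ge : forall s : R, S <= s -> c1 * (X s / (s * Num.sqrt s)) <= dV s;
  chirp_dV_le : forall s : R, S <= s -> dV s <= c2 * (X s / (s * Num.sqrt s));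
  chirp_V_gt0 : 0 < V S;
  chirp_X_le : forall s : R, S <= s -> X s <= C * (Num.sqrt s * V s);
  chirp_unbounded : forall y : R, exists2 s : R, 1 <= s & y <= X s }.

Variables (X dX V dV : R -> R) (S a1 a2 c1 c2 C : R).
Hypothesis ch : chirp X dX V dV S a1 a2 c1 c2 C.

Lemma chirp_X_ndecr s t : 1 <= s -> s <= t -> X s <= X t.
Proof.
move=> s1 st; have dXs := chirp_dX ch; have dX0 := chirp_dX_ge0 ch.
apply: (derive_ge0_ndecr st (chirp_cX ch)) => u /andP[su _].
  by apply: dXs; exact: le_lt_trans su.
by apply: dX0; exact: le_lt_trans su.
Qed.

Lemma chirp_dV_gt0 s : S <= s -> 0 < dV s.
Proof.
move=> Ss; have dVl := chirp_dV_ge ch.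
have s1 : 1 < s by exact: lt_le_trans (chirp_S ch) Ss.
have s0 : 0 < s by exact: lt_trans s1.
apply: lt_le_trans (dVl _ Ss).
rewrite mulr_gt0 ?(chirp_c1 ch)// divr_gt0 ?(chirp_X_gt0 ch)//.
by rewrite mulr_gt0 ?sqrtr_gt0.
Qed.

Lemma chirp_V_ndecr s t : S <= s -> s <= t -> V s <= V t.
Proof.
move=> Ss st; apply: (derive_ge0_ndecr st (chirp_cV ch)) => u /andP[su _].
  by apply: (chirp_dV ch); rewrite (le_trans Ss) ?ltW.
by rewrite ltW// chirp_dV_gt0// (le_trans Ss) ?ltW.
Qed.

Lemma chirp_c2_gt0 : 0 < c2.
Proof.
have S0 : 0 < S by exact: lt_trans (chirp_S ch).
have k0 : 0 < X S / (S * Num.sqrt S).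
  by rewrite divr_gt0 ?(chirp_X_gt0 ch) ?mulr_gt0 ?sqrtr_gt0// (chirp_S ch).
have := lt_le_trans (chirp_dV_gt0 (lexx S)) (chirp_dV_le ch (lexx S)).
by rewrite pmulr_lgt0.
Qed.

Variables (sh a c r S1 : R) (pr pi qr qi : R -> R).
Let dtau s := dX s / s - X s / s ^+ 2.
Hypothesis sol : rotated_solution dX dtau sh a c pr pi qr qi.
Hypothesis sh1 : 1 <= sh.
Hypothesis shS1 : sh <= S1.
Hypothesis SS1 : S <= S1.
Hypothesis S1r : S1 <= r.
Hypothesis acr : a ^+ 2 + c ^+ 2 = r ^+ 2.

Let A s := pr s ^+ 2 + pi s ^+ 2.
Let B s := qr s ^+ 2 + qi s ^+ 2.

(** Put $k=X/s$, so that $s\tau'=X'-k$. The derivative of $N=r|P|^2+s|Q|^2$ is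
    $2(r-s)X'G+|Q|^2+2(X'-k)H$, and AM-GM yields $\sqrt{rs}\,N'\ge-((r-s)X'+r(k-X'))N\ge-rkN$. The
    terms $rX'$ cancel, and the rate left is $\sqrt r\,X/s^{3/2}\le\sqrt r\,V'/c_1$. *)
Lemma inner_phase :
  r * A S1 + S1 * B S1 <=
  (r * A r + r * B r) * expR (Num.sqrt r / c1 * V r - Num.sqrt r / c1 * V S1).
Proof.
pose G s := pr s * qr s + pi s * qi s.
pose H s := (a * pr s - c * pi s) * qr s + (a * pi s + c * pr s) * qi s.
apply: (@gronwall_rev _ (fun s => r * A s + s * B s)
  (fun s => r * (2 * (dX s * G s)) + (B s + s * (2 * (dtau s * H s - dX s * G s))))
  (fun s => Num.sqrt r / c1 * V s) (fun s => Num.sqrt r / c1 * dV s)) => //.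
- have := rot_cA sol; have := rot_cB sol => ? ?; continuous_tac.
- have := chirp_cV ch => ?; continuous_tac.
- move=> s /andP[s1 s2]; have hs : sh < s by exact: le_lt_trans s1.
  have := rot_dA sol hs; have := rot_dB sol hs => dB dA.
  eapply is_derive_eq; first is_derive_tac.
  rewrite /GRing.scale /= /A /B /G /H; ring.
- move=> s /andP[s1 s2]; have hs : S <= s by rewrite (le_trans SS1)// ltW.
  have dVs := chirp_dV ch hs.
  eapply is_derive_eq; first is_derive_tac.
  rewrite /GRing.scale /=; ring.
- move=> s /andP[s1 s2]; have hs : S <= s by rewrite (le_trans SS1)// ltW.
  have sgt1 : 1 < s by exact: lt_le_trans (chirp_S ch) hs.
  have s0 : 0 < s by exact: lt_trans sgt1.
  have r0 : 0 < r by exact: lt_trans s2.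
  have x0 : 0 < Num.sqrt r by rewrite sqrtr_gt0.
  have y0 : 0 < Num.sqrt s by rewrite sqrtr_gt0.
  have A0 : 0 <= A s by rewrite addr_ge0// sqr_ge0.
  have B0 : 0 <= B s by rewrite addr_ge0// sqr_ge0.
  have [Gl _] := scaled_amgm_bounds (ltW x0) (ltW y0) A0 B0 ler01
     (real_form_le (pr s) (pi s) (qr s) (qi s)).
  have [_ Hu] := scaled_amgm_bounds (ltW x0) (ltW y0) A0 B0 (ltW r0)
     (hermitian_form_le (pr s) (pi s) (qr s) (qi s) acr).
  rewrite (sqr_sqrtr (ltW r0)) (sqr_sqrtr (ltW s0)) in Gl Hu; rewrite mul1r in Gl.
  rewrite -/(G s) in Gl; rewrite -/(H s) in Hu.
  have dV1 := chirp_dV_ge ch hs.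
  have d0 := chirp_dX_ge0 ch sgt1.
  have d1 : dX s <= X s / s.
    apply: (le_trans (chirp_dX_le ch hs)).
    apply: ler_piMl; last exact: ltW (chirp_a2 ch).
    by rewrite divr_ge0 ?ltW// (chirp_X_gt0 ch).
  have c0 := chirp_c1 ch.
  set N := r * A s + s * B s in Gl Hu *.
  set x := Num.sqrt r in x0 Gl Hu *.
  set y := Num.sqrt s in y0 Gl Hu dV1 *.
  have x2 : x ^+ 2 = r by rewrite sqr_sqrtr// ltW.
  have y2 : y ^+ 2 = s by rewrite sqr_sqrtr// ltW.
  have N0 : 0 <= N by rewrite addr_ge0// mulr_ge0// ltW.
  pose k := X s / s; rewrite -/k in d1.
  have kE : X s / (s * y) = k / y by rewrite invfM mulrA.
  rewrite kE in dV1.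
  have st : s * dtau s = dX s - k.
    rewrite /dtau /k; field; exact: lt0r_neq0.
  apply: (@le_trans _ _ (- (x / y * k * N))).
    rewrite lerN2; apply: ler_wpM2r => //.
    rewrite (_ : x / y * k = x / c1 * (c1 * (k / y))).
      by apply: ler_wpM2l => //; rewrite divr_ge0// ltW.
    by field; rewrite !lt0r_neq0.
  rewrite -(ler_pM2l (mulr_gt0 x0 y0)).
  have -> : x * y * - (x / y * k * N) = - (r * k * N).
    rewrite -x2; field; exact: lt0r_neq0.
  have -> : x * y * (r * (2 * (dX s * G s)) + (B s + s * (2 * (dtau s * H s - dX s * G s))))
    = (r - s) * dX s * (2 * x * y * G s) + x * y * B s
      + (s * dtau s) * (2 * x * y * H s) by ring.
  rewrite st.
  have e1 : - ((r - s) * dX s * N) <= (r - s) * dX s * (2 * x * y * G s).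
    rewrite -mulrN; apply: ler_wpM2l => //.
    by rewrite mulr_ge0// subr_ge0 ltW.
  have e2 : - ((k - dX s) * (r * N)) <= (dX s - k) * (2 * x * y * H s).
    rewrite -(opprB k) mulNr lerN2; apply: ler_wpM2l => //.
    by rewrite subr_ge0.
  have e3 : 0 <= x * y * B s by rewrite !mulr_ge0// ltW.
  have e4 : 0 <= s * dX s * N by rewrite !mulr_ge0// ltW.
  have -> : - (r * k * N) = - ((r - s) * dX s * N) - s * dX s * N
     - ((k - dX s) * (r * N)) by ring.
  lra.
Qed.

(** On this bounded range the bounds on $sX'/X$ may fail; $X'\ge0$ and $|\tau'|\le X'+X(S_1)$
    suffice for a total exponent of order $\sqrt r$. As [s] is bounded, $|Q|^2$ may carry weight
    1. *)
Lemma outer_phase :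
  r * A sh + B sh <=
  (r * A S1 + B S1) * expR (Num.sqrt r * (X S1 * (2 + S1))).
Proof.
have r1 : 1 < r by apply: lt_le_trans (chirp_S ch) _; exact: le_trans S1r.
have r0 : 0 < r by exact: lt_trans r1.
have XS1 : 0 < X S1.
  by rewrite (chirp_X_gt0 ch)// (lt_le_trans (chirp_S ch)).
have Xsh : 0 <= X sh by rewrite (chirp_X_ge0 ch).
have x0 : 0 < Num.sqrt r by rewrite sqrtr_gt0.
(* $X$ is counted twice: once for the rotation, once for the bound on $|\tau'|$. *)
pose rho s := Num.sqrt r * (2 * X s + X S1 * s).
have A0 s : 0 <= A s by rewrite addr_ge0// sqr_ge0.
have B0 s : 0 <= B s by rewrite addr_ge0// sqr_ge0.
apply: (@le_trans _ _ ((r * A S1 + B S1) * expR (rho S1 - rho sh))); last first.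
  apply: ler_wpM2l; first by rewrite addr_ge0 ?mulr_ge0// ltW.
  rewrite ler_expR /rho -mulrBr; apply: ler_wpM2l; first exact: ltW.
  have : 0 <= X S1 * sh by rewrite mulr_ge0// ?ltW// (lt_le_trans _ sh1).
  lra.
pose G s := pr s * qr s + pi s * qi s.
pose H s := (a * pr s - c * pi s) * qr s + (a * pi s + c * pr s) * qi s.
apply: (@gronwall_rev _ (fun s => r * A s + B s)
  (fun s => r * (2 * (dX s * G s)) + 2 * (dtau s * H s - dX s * G s))
  rho (fun s => Num.sqrt r * (2 * dX s + X S1))) => //.
- have := rot_cA sol; have := rot_cB sol => ? ?; continuous_tac.
- have := chirp_cX ch => ?; rewrite /rho; continuous_tac.
- move=> s /andP[hs _].
  have := rot_dA sol hs; have := rot_dB sol hs => dB dA.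
  eapply is_derive_eq; first is_derive_tac.
  rewrite /GRing.scale /= /A /B /G /H; ring.
- move=> s /andP[hs _].
  have dXs := chirp_dX ch (le_lt_trans sh1 hs).
  eapply is_derive_eq; first is_derive_tac.
  rewrite /GRing.scale /=; ring.
- move=> s /andP[s1 s2]; have sgt1 : 1 < s by exact: le_lt_trans s1.
  have s0 : 0 < s by exact: lt_trans sgt1.
  have [Gl _] := scaled_amgm_bounds (ltW x0) ler01 (A0 s) (B0 s) ler01
     (real_form_le (pr s) (pi s) (qr s) (qi s)).
  have [Hl Hu] := scaled_amgm_bounds (ltW x0) ler01 (A0 s) (B0 s) (ltW r0)
     (hermitian_form_le (pr s) (pi s) (qr s) (qi s) acr).
  rewrite (sqr_sqrtr (ltW r0)) expr1n !mul1r mulr1 in Gl Hl Hu.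
  rewrite -/(G s) in Gl; rewrite -/(H s) in Hl Hu.
  have d0 := chirp_dX_ge0 ch sgt1.
  have XsS1 : X s <= X S1 by apply: chirp_X_ndecr; exact: ltW.
  have Xs := chirp_X_gt0 ch sgt1.
  have si : s^-1 <= 1 by rewrite invf_le1// ltW.
  have si0 : 0 < s^-1 by rewrite invr_gt0.
  set N := r * A s + B s in Gl Hl Hu *.
  set x := Num.sqrt r in x0 Gl Hl Hu *.
  have x2 : x ^+ 2 = r by rewrite sqr_sqrtr// ltW.
  have N0 : 0 <= N by rewrite addr_ge0// mulr_ge0// ltW.
  have dl : - X S1 <= dtau s.
    have -> : dtau s = dX s * s^-1 - X s * (s^-1 * s^-1).
      by rewrite /dtau -exprVn expr2.
    have : 0 <= dX s * s^-1 by rewrite mulr_ge0// ltW.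
    have : X s * (s^-1 * s^-1) <= X s by rewrite ler_piMr ?mulr_ile1// ltW.
    lra.
  have du : dtau s <= dX s + X S1.
    have : dX s / s <= dX s by rewrite ler_piMr.
    have : 0 <= X s / s ^+ 2 by rewrite divr_ge0 ?sqr_ge0// ltW.
    rewrite /dtau; lra.
  rewrite -(ler_pM2l x0).
  have -> : x * - (x * (2 * dX s + X S1) * N) = - (r * (2 * dX s + X S1) * N).
    by rewrite -x2; ring.
  have -> : x * (r * (2 * (dX s * G s)) + 2 * (dtau s * H s - dX s * G s))
    = (r - 1) * dX s * (2 * x * G s) + dtau s * (2 * x * H s) by ring.
  have e1 : - ((r - 1) * dX s * N) <= (r - 1) * dX s * (2 * x * G s).
    rewrite -mulrN; apply: ler_wpM2l => //.
    by rewrite mulr_ge0// subr_ge0 ltW.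
  have e2 : - ((dX s + X S1) * (r * N)) <= dtau s * (2 * x * H s).
    have : `|dtau s * (2 * x * H s)| <= (dX s + X S1) * (r * N).
      rewrite normrM; apply: ler_pM => //; rewrite ler_norml ?Hl//.
      by apply/andP; split => //; lra.
    by rewrite ler_norml => /andP[].
  have e4 : 0 <= dX s * N by rewrite !mulr_ge0// ltW.
  have -> : - (r * (2 * dX s + X S1) * N) = - ((r - 1) * dX s * N) - dX s * N
     - ((dX s + X S1) * (r * N)) by ring.
  lra.
Qed.

End Chirp.

(** * Monotonicity in time of the second row for $z=ir$ *)

Section RowMonotonicity.
Context {R : realType}.
Variables (phi : R -> R) (b r : R) (u0 u1 y0 y1 : R -> R).
Hypothesis sol : row_solution phi b 0 r u0 u1 y0 y1.
Hypothesis r_ge0 : 0 <= r.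
Hypothesis init : [/\ u0 0 = 0, u1 0 = 1, y0 0 = 0 & y1 0 = 0].

(** $E=\mathrm{Im}(\overline{w_{21}}w_{22})$ equals $\mathrm{Im}(Q\overline P)$ by rotation
    invariance, and [dE] is $r|P|^2$. Here [G] and [K] stand for $|w_{21}|^2$ and $|w_{22}|^2$. *)
Let E t := u0 t * y1 t - u1 t * y0 t.
Let dE t := r * ((u0 t * cos (phi t) + u1 t * sin (phi t)) ^+ 2 +
                 (y0 t * cos (phi t) + y1 t * sin (phi t)) ^+ 2).
Let G t := u0 t ^+ 2 + y0 t ^+ 2.
Let K t := u1 t ^+ 2 + y1 t ^+ 2.

Lemma row_continuous : [/\ continuous E, continuous G & continuous K].
Proof. by case: sol => ? ? ? ? _ _ _ _; split; rewrite /E /G /K; continuous_tac. Qed.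

Lemma row_derive t : 0 < t < b ->
  [/\ is_derive t 1 E (dE t),
      is_derive t 1 G (2 * r * E t * sin (phi t) ^+ 2) &
      is_derive t 1 K (2 * r * E t * cos (phi t) ^+ 2)].
Proof.
case: sol => _ _ _ _ du0 du1 dy0 dy1 tb.
have := du0 _ tb; have := du1 _ tb; have := dy0 _ tb; have := dy1 _ tb.
move=> ? ? ? ?; split.
- eapply is_derive_eq; first is_derive_tac.
  rewrite /GRing.scale /= /dE; ring.
- eapply is_derive_eq; first is_derive_tac.
  rewrite /GRing.scale /= /E; ring.
- eapply is_derive_eq; first is_derive_tac.
  rewrite /GRing.scale /= /E; ring.
Qed.

Lemma row_wronskian_ge0 t : 0 <= t <= b -> 0 <= E t.
Proof.
move=> /andP[t0 tb]; have [cE _ _] := row_continuous.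
have -> : 0 = E 0 by case: init => e0 e1 e2 e3; rewrite /E e0 e2 mulr0 mul0r subr0.
apply: (derive_ge0_ndecr t0 cE) => s /andP[s0 st].
  have sb : 0 < s < b by rewrite s0 (lt_le_trans st).
  by have [d _ _] := row_derive sb; exact: d.
by rewrite mulr_ge0// addr_ge0// sqr_ge0.
Qed.

Lemma row_entries_ndecr s t : 0 <= s -> s <= t -> t <= b -> G s <= G t /\ K s <= K t.
Proof.
move=> s0 st tb; have [_ cG cK] := row_continuous.
have ub u : s < u < t -> 0 < u < b.
  by move=> /andP[su ut]; rewrite (le_lt_trans s0)//= (lt_le_trans ut).
have E0 u : s < u < t -> 0 <= E u.
  by move=> /ub /andP[u0' ub']; rewrite row_wronskian_ge0// !ltW.
split.
- apply: (derive_ge0_ndecr st cG) => u su.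
    by have [_ d _] := row_derive (ub _ su); exact: d.
  by rewrite mulr_ge0 ?sqr_ge0// mulr_ge0 ?E0// mulr_ge0.
- apply: (derive_ge0_ndecr st cK) => u su.
    by have [_ _ d] := row_derive (ub _ su); exact: d.
  by rewrite mulr_ge0 ?sqr_ge0// mulr_ge0 ?E0// mulr_ge0.
Qed.

Lemma row_second_entry_ge1 t : 0 <= t <= b -> 1 <= K t.
Proof.
move=> /andP[t0 tb]; have [_] := row_entries_ndecr (lexx 0) t0 tb.
by case: init => _ e1 _ e3; rewrite /K e1 e3 expr1n expr0n addr0.
Qed.

(** $|w_{21}|^2$ grows at rate at most $2rE\le|w_{21}|^2+r^2|w_{22}|^2$, and $|w_{22}|^2$ stays
    below its value at [b]. So Gronwall with unit rate applies to $|w_{21}|^2+r^2|w_{22}(b)|^2$. *)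
Lemma row_norm_le : 0 <= b -> G b + K b <= (1 + r ^+ 2 * expR b) * K b.
Proof.
move=> b0; have [cE cG cK] := row_continuous.
have := @gronwall _ (fun t => G t + r ^+ 2 * K b)
  (fun t => 2 * r * E t * sin (phi t) ^+ 2) (fun t => t) (fun=> 1) 0 b b0.
have G0 : G 0 = 0.
  by case: init => e0 _ e2 _; rewrite /G e0 e2 expr0n addr0.
rewrite G0 add0r subr0 => H.
have {}H : G b + r ^+ 2 * K b <= r ^+ 2 * K b * expR b.
  apply: H.
  - continuous_tac.
  - continuous_tac.
  - move=> t tb; have [_ d _] := row_derive tb.
    eapply is_derive_eq; first is_derive_tac.
    by rewrite addr0.
  - move=> t /andP[t0 tb]; rewrite mul1r.
    have E0 : 0 <= E t by rewrite row_wronskian_ge0// !ltW.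
    have Gt0 : 0 <= G t by rewrite addr_ge0 ?sqr_ge0.
    have Kt0 : 0 <= K t by rewrite addr_ge0 ?sqr_ge0.
    have [_ Kb] := row_entries_ndecr (ltW t0) (ltW tb) (lexx b).
    have s1 : sin (phi t) ^+ 2 <= 1.
      by rewrite -(cos2Dsin2 (phi t)) lerDr sqr_ge0.
    apply: (@le_trans _ _ (2 * r * E t)).
      by rewrite ler_piMr// !mulr_ge0.
    have hE : E t ^+ 2 <= 1 ^+ 2 * (G t * K t).
      rewrite -subr_ge0.
      have -> : 1 ^+ 2 * (G t * K t) - E t ^+ 2 = (u0 t * u1 t + y0 t * y1 t) ^+ 2.
        by rewrite /G /K /E; ring.
      exact: sqr_ge0.
    have [_] := scaled_amgm_bounds ler01 r_ge0 Gt0 Kt0 ler01 hE.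
    rewrite mulr1 expr1n !mul1r => /le_trans; apply.
    by rewrite lerD2l; apply: ler_wpM2l => //; exact: sqr_ge0.
have : 0 <= r ^+ 2 * K b by rewrite mulr_ge0 ?sqr_ge0 ?addr_ge0 ?sqr_ge0.
rewrite mulrDl mul1r; move: H; rewrite -!mulrA [K b * _]mulrC; lra.
Qed.

End RowMonotonicity.

(** * Growth of $2E-G$ on the middle range of [s] *)

Section LowerPhase.
Context {R : realType}.
Variables (X dX V dV : R -> R) (S a1 a2 c1 c2 C : R).
Hypothesis ch : chirp X dX V dV S a1 a2 c1 c2 C.
Variables (sh r S1 S2 S3 : R) (pr pi qr qi : R -> R).
Let dtau s := dX s / s - X s / s ^+ 2.
Hypothesis sol : rotated_solution dX dtau sh 0 r pr pi qr qi.
Hypothesis shS1 : sh <= S1.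
Hypothesis SS1 : S <= S1.
Hypothesis S12 : S1 <= S2.
Hypothesis S23 : S2 <= S3.
Hypothesis S3r : S3 <= (1 - a2) * r.

Let A s := pr s ^+ 2 + pi s ^+ 2.
Let B s := qr s ^+ 2 + qi s ^+ 2.
Let G s := pr s * qr s + pi s * qi s.
Let E s := pr s * qi s - pi s * qr s.
Let L s := 2 * E s - G s.
Let dL s := 2 * (dtau s * (r * A s)) - dX s * (B s - A s).
(** A common lower bound: $X'\ge\mu X/s$ and $-s\tau'\ge\mu X/s$. *)
Let mu := Num.min a1 (1 - a2).

Hypothesis E_ge0 : forall s, sh < s -> 0 <= E s.
Hypothesis norm_nincr : forall s, S1 <= s -> s <= S3 ->
  A S3 + B S3 <= A s + B s.
Hypothesis norm_ge1 : 1 <= A S3 + B S3.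
Hypothesis X_gap : 1 <= X S3 - X S2.

(** $-L'=2r|\tau'||P|^2+X'(|Q|^2-|P|^2)$, and one of the two copies of $r|\tau'||P|^2$ pays for the
    negative term. What remains is at least $\mu X s^{-2}(r|P|^2+s|Q|^2)$. The factor 2/3 comes from
    $\sqrt{rs}\,(2E-G)\le\frac32(r|P|^2+s|Q|^2)$. *)
Lemma lower_dL s : S1 < s < S3 ->
  dX s * (A s + B s) <= - dL s /\
  2 / 3 * mu * (X s / (s * Num.sqrt s)) * Num.sqrt r * L s <= - dL s.
Proof.
move=> /andP[s1 s2].
have Ss : S <= s by rewrite (le_trans SS1)// ltW.
have sgt1 : 1 < s by exact: lt_le_trans (chirp_S ch) Ss.
have s0 : 0 < s by exact: lt_trans sgt1.
have sr : s <= (1 - a2) * r by rewrite (le_trans _ S3r)// ltW.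
have a20 : 0 < 1 - a2 by rewrite subr_gt0 (chirp_a2 ch).
have r0 : 0 < r by rewrite -(pmulr_rgt0 _ a20) (lt_le_trans s0).
have x0 : 0 < Num.sqrt r by rewrite sqrtr_gt0.
have y0 : 0 < Num.sqrt s by rewrite sqrtr_gt0.
have A0 : 0 <= A s by rewrite addr_ge0// sqr_ge0.
have B0 : 0 <= B s by rewrite addr_ge0// sqr_ge0.
have [Gl _] := scaled_amgm_bounds (ltW x0) (ltW y0) A0 B0 ler01
   (real_form_le (pr s) (pi s) (qr s) (qi s)).
have [_ Eu] := scaled_amgm_bounds (ltW x0) (ltW y0) A0 B0 ler01
   (imag_form_le (pr s) (pi s) (qr s) (qi s)).
rewrite (sqr_sqrtr (ltW r0)) (sqr_sqrtr (ltW s0)) mul1r in Gl Eu.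
rewrite -/(G s) in Gl; rewrite -/(E s) in Eu.
have Xs := chirp_X_gt0 ch sgt1.
have d0 := chirp_dX_ge0 ch sgt1.
have dl := chirp_dX_ge ch Ss.
have du := chirp_dX_le ch Ss.
pose k := X s / s; rewrite -/k in dl du.
have k0 : 0 < k by rewrite divr_gt0.
have mu0 : 0 < mu by rewrite lt_min (chirp_a1 ch) a20.
have mu1 : mu <= a1 by rewrite ge_min lexx.
have mu2 : mu <= 1 - a2 by rewrite ge_min lexx orbT.
set x := Num.sqrt r in x0 Gl Eu *.
set y := Num.sqrt s in y0 Gl Eu *.
have x2 : x ^+ 2 = r by rewrite sqr_sqrtr// ltW.
have y2 : y ^+ 2 = s by rewrite sqr_sqrtr// ltW.
have kE : X s / (s * y) = k / y by rewrite invfM mulrA.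
have st : - dtau s = (k - dX s) / s.
  rewrite /dtau /k; field; exact: lt0r_neq0.
have dtE : - (dtau s * r) = (k - dX s) * (r / s).
  by rewrite -mulNr st; field; exact: lt0r_neq0.
have tl : mu * k * (r / s) <= - (dtau s * r).
  rewrite dtE; apply: ler_wpM2r; first by rewrite divr_ge0// ltW.
  have : mu * k <= (1 - a2) * k by apply: ler_wpM2r => //; exact: ltW.
  lra.
(* With $s\le(1-a_2)r$: $r|\tau'|\ge(1-a_2)kr/s\ge k\ge X'$. *)
have tk : dX s <= - (dtau s * r).
  have h1 : (1 - a2) * k * (r / s) <= (k - dX s) * (r / s).
    by apply: ler_wpM2r; [rewrite divr_ge0// ltW|lra].
  have h2 : k * 1 <= k * ((1 - a2) * r / s).
    by apply: ler_wpM2l; [exact: ltW|rewrite ler_pdivlMr// mul1r].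
  have h3 : a2 * k <= k by rewrite ger_pMl// ltW// (chirp_a2 ch).
  rewrite dtE; apply: le_trans h1; rewrite mulr1 in h2.
  rewrite [_ * k]mulrC -!mulrA in h2 *; lra.
have LB : (r / s) * mu * k * A s + mu * k * B s <= - dL s.
  have e1 : mu * k * (r / s) * A s <= - (dtau s * r) * A s by exact: ler_wpM2r.
  have e2 : dX s * A s <= - (dtau s * r) * A s by exact: ler_wpM2r.
  have e3 : mu * k * B s <= dX s * B s.
    apply: ler_wpM2r => //; apply: le_trans dl; apply: ler_wpM2r => //.
    exact: ltW.
  rewrite /dL; lra.
split.
  have e2 : dX s * A s <= - (dtau s * r) * A s by exact: ler_wpM2r.
  rewrite /dL; lra.
apply: le_trans LB.
have -> : 2 / 3 * mu * (X s / (s * y)) * x * L s =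
  2 / 3 * mu * k / s * (x * y * L s).
  by rewrite kE -y2; field; exact: lt0r_neq0.
have -> : r / s * mu * k * A s + mu * k * B s =
  2 / 3 * mu * k / s * (3 / 2 * (r * A s + s * B s)).
  by field; exact: lt0r_neq0.
apply: ler_wpM2l; first by rewrite !mulr_ge0 ?invr_ge0 ?ltW.
rewrite /L; lra.
Qed.

(** The stretch $[S_2,S_3]$ makes [L] positive and $[S_1,S_2]$ amplifies it. The constant 3 is
    $\frac32/\frac12$, from $L(S_1)\le\frac32(A+B)(S_1)$ and $L(S_2)\ge\frac12$. *)
Lemma lower_phase :
  expR (2 / 3 * (mu / c2) * Num.sqrt r * (V S2 - V S1)) <= 3 * (A S1 + B S1).
Proof.
have a20 : 0 < 1 - a2 by rewrite subr_gt0 (chirp_a2 ch).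
have mu0 : 0 < mu by rewrite lt_min (chirp_a1 ch) a20.
have c20 := chirp_c2_gt0 ch.
have cL : continuous L.
  by have := rot_cE sol; have := rot_cG sol => ? ?; rewrite /L; continuous_tac.
have dLs s : S1 < s -> is_derive s 1 L (dL s).
  move=> s1; have hs : sh < s by exact: le_lt_trans s1.
  have := rot_dE sol hs; have := rot_dG sol hs => ? ?.
  eapply is_derive_eq; first is_derive_tac.
  rewrite /GRing.scale /= /dL /A /B; ring.
have quad s : - (A s + B s) <= 2 * G s /\ 2 * G s <= A s + B s /\ 2 * E s <= A s + B s.
  have A0 : 0 <= A s by rewrite addr_ge0// sqr_ge0.
  have B0 : 0 <= B s by rewrite addr_ge0// sqr_ge0.
  have [Gl Gu] := scaled_amgm_bounds ler01 ler01 A0 B0 ler01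
    (real_form_le (pr s) (pi s) (qr s) (qi s)).
  have [_ Eu] := scaled_amgm_bounds ler01 ler01 A0 B0 ler01
    (imag_form_le (pr s) (pi s) (qr s) (qi s)).
  by rewrite expr1n !mulr1 !mul1r in Gl Gu Eu.
pose M := A S3 + B S3.
have S23' : S2 < S3.
  rewrite lt_neqAle S23 andbT; apply/eqP => e; move: X_gap; rewrite e subrr; lra.
have sh3 : sh < S3 by rewrite (le_lt_trans shS1)// (le_lt_trans S12).
have gt1 s : S1 <= s -> 1 < s.
  by move=> h; apply: lt_le_trans (chirp_S ch) _; exact: le_trans h.
(* $E\ge0$ gives $L(S_3)\ge-M/2$, and towards $S_2$ the form gains at least $M$ times the increment
   of [X], so $L(S_2)\ge M/2$. *)
have L2 : 1 / 2 <= L S2.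
  have : L S3 + M * X S3 <= L S2 + M * X S2.
    apply: (@derive_le0_nincr _ (fun s => L s + M * X s) (fun s => dL s + M * dX s)) => //.
    - by have := chirp_cX ch => ?; continuous_tac.
    - move=> s /andP[s2 s3]; have s1 : S1 < s by exact: le_lt_trans s2.
      have := dLs _ s1; have := chirp_dX ch (gt1 _ (ltW s1)) => ? ?.
      eapply is_derive_eq; first is_derive_tac.
      rewrite /GRing.scale /=; ring.
    - move=> s /andP[s2 s3]; have s1 : S1 < s by exact: le_lt_trans s2.
      have s13 : S1 < s < S3 by rewrite s1.
      have [h _] := lower_dL s13.
      have := ler_wpM2l (chirp_dX_ge0 ch (gt1 _ (ltW s1))) (norm_nincr (ltW s1) (ltW s3)).
      rewrite -/M; lra.
  have M1 : 1 <= M by [].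
  have := ler_wpM2l (le_trans ler01 M1) X_gap.
  have := E_ge0 sh3; have [_ [h _]] := quad S3; rewrite -/M in h.
  rewrite /L; rewrite /L; lra.
(* Positivity is what permits replacing $X/s^{3/2}$ in the rate by the smaller $V'/c_2$. *)
have Lpos s : S1 <= s -> s <= S2 -> 1 / 2 <= L s.
  move=> s1 s2; apply: (le_trans L2).
  apply: (@derive_le0_nincr _ L dL _ _ s2 cL) => u /andP[su uS].
    by apply: dLs; exact: le_lt_trans su.
  have u1 : S1 < u by exact: le_lt_trans su.
  have u13 : S1 < u < S3 by rewrite u1 (lt_trans uS).
  have [h _] := lower_dL u13.
  have : 0 <= dX u * (A u + B u).
    apply: mulr_ge0; first by rewrite (chirp_dX_ge0 ch)// gt1// ltW.
    by rewrite !addr_ge0 ?sqr_ge0.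
  lra.
pose kap := 2 / 3 * (mu / c2) * Num.sqrt r.
have := @gronwall _ L dL (fun s => - kap * V s) (fun s => - kap * dV s) S1 S2 S12 cL.
have -> : - kap * V S2 - - kap * V S1 = - (kap * (V S2 - V S1)) by ring.
move=> H.
have {}H : L S2 <= L S1 * expR (- (kap * (V S2 - V S1))).
  apply: H.
  - by have := chirp_cV ch => ?; continuous_tac.
  - by move=> s /andP[s1 _]; exact: dLs.
  - move=> s /andP[s1 s2].
    have := chirp_dV ch (le_trans SS1 (ltW s1)) => ?.
    eapply is_derive_eq; first is_derive_tac.
    rewrite /GRing.scale /=; ring.
  - move=> s /andP[s1 s2].
    have s13 : S1 < s < S3 by rewrite s1 (lt_trans s2).
    have [_ h] := lower_dL s13.
    have L0 : 0 <= L s by apply: le_trans (Lpos _ (ltW s1) (ltW s2)); rewrite divr_ge0.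
    have dVu := chirp_dV_le ch (le_trans SS1 (ltW s1)).
    suff : kap * dV s * L s <= 2 / 3 * mu * (X s / (s * Num.sqrt s)) * Num.sqrt r * L s.
      rewrite !mulNr; lra.
    apply: ler_wpM2r => //.
    have -> : kap * dV s = 2 / 3 * mu * (dV s / c2) * Num.sqrt r.
      by rewrite /kap; field; exact: lt0r_neq0.
    apply: ler_wpM2r; first exact: sqrtr_ge0.
    apply: ler_wpM2l; first by rewrite !mulr_ge0 ?invr_ge0// ltW.
    by rewrite ler_pdivrMr// mulrC.
rewrite expRN ler_pdivlMr ?expR_gt0// in H.
rewrite -/kap.
have [h1 [h2 h3]] := quad S1.
have LS1 : L S1 <= 3 / 2 * (A S1 + B S1) by rewrite /L; lra.
have := ler_wpM2r (expR_ge0 (kap * (V S2 - V S1))) L2.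
lra.
Qed.

End LowerPhase.

(** * Passage between time and [s]; upper and lower bounds for a row at time [b] *)

Section Assembly.
Context {R : realType}.
Variables (X dX V dV : R -> R) (S a1 a2 c1 c2 C : R).
Hypothesis ch : chirp X dX V dV S a1 a2 c1 c2 C.
Variables (tau phi : R -> R) (sh b : R).
Hypothesis ctau : continuous tau.
Hypothesis tauE : forall s, 1 <= s -> tau s = X s / s.
Hypothesis sh1 : 1 <= sh.
Hypothesis Xsh_gt0 : 0 < X sh.
Hypothesis tau_decr : forall s t, sh <= s -> s < t -> tau t < tau s.
Hypothesis bE : b = tau sh.
Hypothesis phi_tau : forall s, sh <= s -> phi (tau s) = X s.

Let dtau s := dX s / s - X s / s ^+ 2.

Lemma tau_gt0 s : sh <= s -> 0 < tau s.
Proof.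
move=> hs; have s1 : 1 <= s by exact: le_trans hs.
rewrite tauE// divr_gt0// ?(lt_le_trans _ s1)//.
by apply: (lt_le_trans Xsh_gt0); exact: (chirp_X_ndecr ch).
Qed.

Lemma derive_tau s : sh < s -> is_derive s 1 tau (dtau s).
Proof.
move=> hs; have s1 : 1 < s by exact: le_lt_trans hs.
have s0 : s != 0 by rewrite gt_eqF// (lt_trans _ s1).
apply: (@locally_eq_is_derive _ (fun s => X s * s^-1) _ _ _ 1 (s + 1)).
- by rewrite s1 ltrDl ltr01.
- by move=> y /andP[y1 _]; rewrite tauE// ltW.
- have d1 := chirp_dX ch s1.
  have d2 := is_derive_invf s0 (is_derive_idf s).
  eapply is_derive_eq; first is_derive_tac.
  rewrite /GRing.scale /= /dtau; field; exact: s0.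
Qed.

Section Row.
Variables (a c : R) (u0 u1 y0 y1 : R -> R).
Hypothesis sol : row_solution phi b a c u0 u1 y0 y1.

Let pr s := u0 (tau s) * cos (X s) + u1 (tau s) * sin (X s).
Let pi s := y0 (tau s) * cos (X s) + y1 (tau s) * sin (X s).
Let qr s := u1 (tau s) * cos (X s) - u0 (tau s) * sin (X s).
Let qi s := y1 (tau s) * cos (X s) - y0 (tau s) * sin (X s).

Lemma chirp_rotate : rotated_solution dX dtau sh a c pr pi qr qi.
Proof.
apply: (rotate_row sol) => //.
- exact: chirp_cX ch.
- by move=> s hs; apply: (chirp_dX ch); exact: le_lt_trans hs.
- exact: derive_tau.
- by move=> s hs; rewrite tau_gt0 ?bE ?tau_decr// ltW.
- by move=> s hs; rewrite phi_tau// ltW.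
Qed.

Lemma chirp_norm s :
  pr s ^+ 2 + pi s ^+ 2 + (qr s ^+ 2 + qi s ^+ 2) =
  u0 (tau s) ^+ 2 + u1 (tau s) ^+ 2 + (y0 (tau s) ^+ 2 + y1 (tau s) ^+ 2).
Proof. exact: rotate_norm. Qed.

End Row.

Lemma tau_itv s : sh <= s -> 0 <= tau s <= b.
Proof.
move=> hs; rewrite ltW ?tau_gt0//= bE.
by move: hs; rewrite le_eqVlt => /orP[/eqP->//|hs]; rewrite ltW// tau_decr.
Qed.

Lemma chirp_upper : exists Cu r0 : R, 0 < Cu /\
  forall (r a c : R) (u0 u1 y0 y1 : R -> R), r0 <= r -> a ^+ 2 + c ^+ 2 = r ^+ 2 ->
  row_solution phi b a c u0 u1 y0 y1 ->
  u0 0 ^+ 2 + u1 0 ^+ 2 + (y0 0 ^+ 2 + y1 0 ^+ 2) = 1 ->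
  u0 b ^+ 2 + u1 b ^+ 2 + (y0 b ^+ 2 + y1 b ^+ 2) <=
    expR (Cu * (Num.sqrt r * V r)).
Proof.
pose S1 := Num.max S sh.
have SS1 : S <= S1 by rewrite le_max lexx.
have shS1 : sh <= S1 by rewrite le_max lexx orbT.
have S11 : 1 < S1 by exact: lt_le_trans (chirp_S ch) SS1.
pose K := X S1 * (2 + S1).
have K0 : 0 <= K.
  by rewrite mulr_ge0 ?addr_ge0 ?ltW ?(chirp_X_gt0 ch)// (lt_trans _ S11).
have V0 := chirp_V_gt0 ch.
have C0 : 0 < C.
  have := lt_le_trans (chirp_X_gt0 ch (chirp_S ch)) (chirp_X_le ch (lexx S)).
  rewrite pmulr_lgt0// mulr_gt0// sqrtr_gt0.
  by rewrite (lt_trans _ (chirp_S ch)).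
(* [C] pays for the times before $\tau(r)$, [c1^-1] for the inner phase, [K] for the outer phase and
   2 for the weight $r\le e^{2\sqrt r}$. Division by [V S] turns $\sqrt r$ into a multiple of $\sqrt
   r\,V(r)$. *)
exists (C + (c1^-1 + (K + 2) / V S)), S1; split.
  by rewrite addr_gt0// addr_gt0 ?invr_gt0 ?(chirp_c1 ch)// divr_gt0// ltr_wpDl.
move=> r a c u0 u1 y0 y1 S1r acr sol M0.
have r1 : 1 < r by exact: lt_le_trans S1r.
have r0 : 0 < r by exact: lt_trans r1.
have Sr : S <= r by exact: le_trans S1r.
have shr : sh <= r by exact: le_trans S1r.
have rot := chirp_rotate sol.
have P1 := inner_phase ch rot shS1 SS1 S1r acr.
have P2 := outer_phase ch rot sh1 shS1 SS1 S1r acr.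
have tr : 0 <= tau r <= b by exact: tau_itv.
have rt : r * tau r = X r by rewrite tauE ?ltW// mulrC divfK// gt_eqF.
have := row_growth sol (ltW r0) acr tr; rewrite M0 mul1r rt -chirp_norm => P0.
rewrite bE -chirp_norm.
move: P0 P1 P2.
set Ar := (_ ^+ 2 + _ ^+ 2); set Br := (_ ^+ 2 + _ ^+ 2).
set A1 := (_ ^+ 2 + _ ^+ 2); set B1 := (_ ^+ 2 + _ ^+ 2).
set Ah := (_ ^+ 2 + _ ^+ 2); set Bh := (_ ^+ 2 + _ ^+ 2).
have Ar0 : 0 <= Ar by rewrite addr_ge0// sqr_ge0.
have Br0 : 0 <= Br by rewrite addr_ge0// sqr_ge0.
have A10 : 0 <= A1 by rewrite addr_ge0// sqr_ge0.
have B10 : 0 <= B1 by rewrite addr_ge0// sqr_ge0.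
have Ah0 : 0 <= Ah by rewrite addr_ge0// sqr_ge0.
have Bh0 : 0 <= Bh by rewrite addr_ge0// sqr_ge0.
move=> P0 P1 P2.
pose F := Num.sqrt r * V r.
have x0 : 0 < Num.sqrt r by rewrite sqrtr_gt0.
have VSr : V S <= V r by exact: (chirp_V_ndecr ch (lexx S) Sr).
have xF : Num.sqrt r <= F / V S.
  by rewrite ler_pdivlMr// ler_wpM2l// ltW.
have rexp : r <= expR (2 * Num.sqrt r).
  have h : Num.sqrt r <= expR (Num.sqrt r).
    by apply: le_trans (expR_ge1Dx _); rewrite lerDr.
  rewrite -[leLHS](sqr_sqrtr (ltW r0)) expRM_natl.
  by rewrite ler_pXn2r// nnegrE ?expR_ge0// ltW.
have VS1 : 0 <= V S1.
  by apply: (le_trans (ltW V0)); exact: (chirp_V_ndecr ch (lexx S)).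
apply: (@le_trans _ _ (r * Ah + Bh)).
  by rewrite lerD2r ler_peMl// ltW.
apply: (le_trans P2).
apply: (@le_trans _ _ ((expR (2 * Num.sqrt r) * expR (X r) * expR (F / c1))
  * expR (Num.sqrt r * K))).
  apply: ler_wpM2r; first exact: expR_ge0.
  apply: (@le_trans _ _ (r * A1 + S1 * B1)).
    by rewrite lerD2l ler_peMl// ltW.
  apply: (le_trans P1); rewrite -mulrDr.
  have h1 : r * (Ar + Br) <= expR (2 * Num.sqrt r) * expR (X r).
    by apply: ler_pM => //; [exact: ltW|exact: addr_ge0].
  apply: ler_pM => //; first by apply: mulr_ge0; [exact: ltW|exact: addr_ge0].
  rewrite ler_expR /F.
  have : 0 <= Num.sqrt r / c1 * V S1.
    by rewrite mulr_ge0// divr_ge0 ?ltW// (chirp_c1 ch).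
  rewrite [Num.sqrt r / c1 * V r]mulrAC; lra.
rewrite -!expRD ler_expR.
have Xr := chirp_X_le ch Sr; rewrite -/F in Xr *.
have K2 : 0 <= K + 2 by rewrite addr_ge0.
have := ler_wpM2l K2 xF.
have -> : (C + (c1^-1 + (K + 2) / V S)) * F = C * F + (F / c1 + (K + 2) * (F / V S)).
  by ring.
lra.
Qed.

(** On $[s,2s]$ one has $X'\ge a_1X(s)/(2s)$, so the increment is at least $a_1X(s)/2$, and [X] is
    unbounded. *)
Lemma chirp_gap : exists r0 : R, forall s, r0 <= s -> 1 <= X (2 * s) - X s.
Proof.
have a10 := chirp_a1 ch.
have [s0 s01 Xs0] := chirp_unbounded ch (2 / a1).
exists (Num.max S s0) => s; rewrite ge_max => /andP[Ss s0s].
have s1 : 1 < s by exact: lt_le_trans (chirp_S ch) Ss.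
have sp : 0 < s by exact: lt_trans s1.
have s2 : s <= 2 * s by lra.
have Xs : 2 / a1 <= X s by apply: (le_trans Xs0); exact: (chirp_X_ndecr ch).
pose m := a1 * (X s / (2 * s)).
have cX := chirp_cX ch.
have : X s - m * s <= X (2 * s) - m * (2 * s).
  apply: (@derive_ge0_ndecr _ (fun t => X t - m * t) (fun t => dX t - m)) => //.
  - by continuous_tac.
  - move=> t /andP[st _]; have := chirp_dX ch (lt_trans s1 st) => ?.
    eapply is_derive_eq; first is_derive_tac.
    rewrite /GRing.scale /=; ring.
  - move=> t /andP[st ts]; rewrite subr_ge0.
    apply: le_trans (chirp_dX_ge ch (le_trans Ss (ltW st))).
    apply: ler_wpM2l; first exact: ltW.
    have t0 : 0 < t by exact: lt_trans st.
    apply: ler_pM => //.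
    + by rewrite ltW// (chirp_X_gt0 ch).
    + by rewrite invr_ge0 mulr_ge0// ltW.
    + by apply: (chirp_X_ndecr ch); exact: ltW.
    + by rewrite lef_pV2 ?posrE ?mulr_gt0// ltW.
have -> : m * (2 * s) = a1 * X s by rewrite /m; field; exact: lt0r_neq0.
have -> : m * s = a1 * X s / 2 by rewrite /m; field; exact: lt0r_neq0.
rewrite ler_pdivrMr// in Xs.
lra.
Qed.

(** $V'\le c_2X/t^{3/2}\le c_2C\,V/t$, so values of [V] at comparable arguments are comparable. *)
Lemma chirp_doubling (s r : R) : S <= s -> s <= r ->
  V r <= V s * expR (c2 * C * ((r - s) / s)).
Proof.
move=> Ss sr.
have s0 : 0 < s by rewrite (lt_le_trans _ Ss)// (lt_trans _ (chirp_S ch)).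
have c20 := chirp_c2_gt0 ch.
rewrite (_ : c2 * C * ((r - s) / s) = c2 * C / s * r - c2 * C / s * s); last first.
  by field; exact: lt0r_neq0.
apply: (@gronwall _ V dV (fun t => c2 * C / s * t) (fun=> c2 * C / s)) => //.
- exact: chirp_cV ch.
- by continuous_tac.
- move=> t /andP[st _]; apply: (chirp_dV ch); exact: le_trans (ltW st).
- move=> t _; eapply is_derive_eq; first is_derive_tac.
  rewrite /GRing.scale /=; ring.
- move=> t /andP[st _]; have St : S <= t by exact: le_trans (ltW st).
  have t0 : 0 < t by exact: lt_trans st.
  have y0 : 0 < Num.sqrt t by rewrite sqrtr_gt0.
  have Vt : 0 < V t by apply: lt_le_trans (chirp_V_gt0 ch) _; exact: (chirp_V_ndecr ch).
  apply: (le_trans (chirp_dV_le ch St)).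
  rewrite -!mulrA; apply: ler_wpM2l; first exact: ltW.
  have CV : X t / (t * Num.sqrt t) <= C * V t / t.
    rewrite invfM mulrA mulrAC; apply: ler_wpM2r; first by rewrite invr_ge0 ltW.
    by rewrite ler_pdivrMr// -mulrA [V t * _]mulrC (chirp_X_le ch).
  have CV0 : 0 <= C * V t.
    have := chirp_X_le ch St; have := chirp_X_gt0 ch.
    move=> /(_ t (lt_le_trans (chirp_S ch) St)) X0 /(lt_le_trans X0); rewrite mulrCA pmulr_rgt0//.
    exact: ltW.
  apply: (le_trans CV).
  have -> : C * (s^-1 * V t) = C * V t * s^-1 by ring.
  apply: ler_wpM2l => //.
  by rewrite lef_pV2 ?posrE// ltW.
Qed.

(** The fifth power of $y\le e^y$ at $y=c\sqrt r/5$ gives a multiple of $\sqrt r\,r^2$; the spare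
    $\sqrt r$ beats [k]. *)
Lemma polynomial_le_expR (c k : R) : 0 < c ->
  exists r0 : R, 0 < r0 /\ forall r, r0 <= r -> k * r ^+ 2 <= expR (c * Num.sqrt r).
Proof.
move=> c0; pose d := (c / 5) ^+ 5.
have d0 : 0 < d by rewrite exprn_gt0// divr_gt0.
exists (1 + (`|k| / d) ^+ 2); split; first by rewrite ltr_pwDl// sqr_ge0.
move=> r hr.
have r0 : 0 < r by apply: lt_le_trans hr; rewrite ltr_pwDl// sqr_ge0.
have x0 : 0 < Num.sqrt r by rewrite sqrtr_gt0.
have kx : `|k| <= d * Num.sqrt r.
  have kd : 0 <= `|k| / d by apply: divr_ge0; rewrite // ltW.
  rewrite mulrC -ler_pdivrMr// -[leLHS](ger0_norm kd) -sqrtr_sqr.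
  by rewrite ler_wsqrtr// (le_trans _ hr)// lerDr.
have -> : c * Num.sqrt r = 5%:R * (c / 5 * Num.sqrt r).
  by rewrite mulrA mulrCA divff ?mulr1// pnatr_eq0.
rewrite expRM_natl; apply: (@le_trans _ _ ((c / 5 * Num.sqrt r) ^+ 5)).
  have -> : (c / 5 * Num.sqrt r) ^+ 5 = (d * Num.sqrt r) * r ^+ 2.
    by rewrite -[X in _ = _ * X ^+ 2](sqr_sqrtr (ltW r0)) /d; ring.
  apply: ler_wpM2r; first exact: sqr_ge0.
  exact: le_trans (ler_norm _) kx.
have y0 : 0 <= c / 5 * Num.sqrt r by rewrite mulr_ge0 ?divr_ge0 ?ltW.
rewrite ler_pXn2r// ?nnegrE ?expR_ge0//.
by apply: le_trans (expR_ge1Dx _); rewrite lerDr.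
Qed.

Lemma chirp_lower : exists cl r0 : R, 0 < cl /\
  forall (r : R) (u0 u1 y0 y1 : R -> R), r0 <= r ->
  row_solution phi b 0 r u0 u1 y0 y1 ->
  [/\ u0 0 = 0, u1 0 = 1, y0 0 = 0 & y1 0 = 0] ->
  expR (cl * (Num.sqrt r * V r)) <= u1 b ^+ 2 + y1 b ^+ 2.
Proof.
pose S1 := Num.max S sh.
have SS1 : S <= S1 by rewrite le_max lexx.
have shS1 : sh <= S1 by rewrite le_max lexx orbT.
have S11 : 1 < S1 by exact: lt_le_trans (chirp_S ch) SS1.
have S10 : 0 < S1 by exact: lt_trans S11.
have V0 := chirp_V_gt0 ch.
have a20 : 0 < 1 - a2 by rewrite subr_gt0 (chirp_a2 ch).
have c20 := chirp_c2_gt0 ch.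
pose mu := Num.min a1 (1 - a2).
have mu0 : 0 < mu by rewrite lt_min (chirp_a1 ch) a20.
have VS1 : 0 < V S1 by apply: (lt_le_trans V0); exact: (chirp_V_ndecr ch).
have V12 : V S1 < V (2 * S1).
  have S12 : S1 < 2 * S1 by lra.
  have dFx x : x \in `]S1, (2 * S1)[ -> is_derive x 1 V (dV x).
    rewrite in_itv => /andP[h _]; apply: (chirp_dV ch).
    exact: le_trans (ltW h).
  have [t] := MVT S12 dFx (continuous_subspaceT (chirp_cV ch)).
  rewrite in_itv => /andP[h _] e; rewrite -subr_gt0 e mulr_gt0 ?subr_gt0//.
  by rewrite (chirp_dV_gt0 ch)// (le_trans SS1)// ltW.
(* Chosen so that $V(S_2)-V(S_1)\ge\delta V(S_2)$ whenever $S_2\ge2S_1$. *)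
pose del := 1 - V S1 / V (2 * S1).
have del0 : 0 < del by rewrite subr_gt0 ltr_pdivrMr ?mul1r// (lt_trans VS1).
(* This is $(r-S_2)/S_2$ for $S_2=(1-a_2)r/2$, so that $V(r)\le D\,V(S_2)$. *)
pose th := 2 / (1 - a2) - 1.
pose D := expR (c2 * C * th).
have D0 : 0 < D by exact: expR_gt0.
pose kap := 2 / 3 * (mu / c2).
have kap0 : 0 < kap by rewrite mulr_gt0// divr_gt0.
(* Half of the exponent is given up to absorb $3(1+r^2e^b)$, the price of passing from the whole row
   to $w_{22}$. *)
pose cl := kap * del / D / 2.
have cl0 : 0 < cl by rewrite !divr_gt0// mulr_gt0.
have [r1 gap] := chirp_gap.
have [r2 [r20 poly]] := @polynomial_le_expR (cl * V S) (6 * expR b) (mulr_gt0 cl0 V0).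
have b0 : 0 < b by rewrite bE tau_gt0.
exists cl, (Num.max (Num.max 1 r2) (2 / (1 - a2) * Num.max (2 * S1) r1)); split => //.
move=> r u0 u1 y0 y1; rewrite !ge_max -!andbA => /and3P[r_ge1 r2r hr] sol init.
have r0 : 0 < r by exact: lt_le_trans r_ge1.
(* $2S_2=(1-a_2)r$ is the top of the admissible range, and the gap estimate applies to
   $[S_2,2S_2]$. *)
pose S2 := (1 - a2) * r / 2.
have {}hr : Num.max (2 * S1) r1 <= S2.
  move: hr; rewrite mulrAC ler_pdivrMr// /S2; lra.
move: hr; rewrite ge_max => /andP[S12' r1S2].
have S12 : S1 <= S2 by apply: le_trans S12'; lra.
have S20 : 0 < S2 by exact: lt_le_trans S12.
have E3 : 2 * S2 = (1 - a2) * r by rewrite /S2 mulrC divfK// pnatr_eq0.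
have S23 : S2 <= 2 * S2 by lra.
have S3r : 2 * S2 <= (1 - a2) * r by rewrite E3.
have a2pos : 0 <= a2.
  have h1 := le_trans (chirp_dX_ge ch SS1) (chirp_dX_le ch SS1).
  have k0 : 0 < X S1 / S1 by rewrite divr_gt0// (chirp_X_gt0 ch).
  by move: h1; rewrite ler_pM2r// => /(lt_le_trans (chirp_a1 ch)) /ltW.
have S2r : S2 <= r.
  apply: (le_trans S23); rewrite E3; apply: ler_piMl; lra.
have rot := chirp_rotate sol.
have ge0b : 0 <= b by exact: ltW.
have wr := row_wronskian_ge0 sol (ltW r0) init.
have mono := row_entries_ndecr sol (ltW r0) init.
have nrm s : S1 <= s -> s <= 2 * S2 ->
   u0 (tau (2 * S2)) ^+ 2 + u1 (tau (2 * S2)) ^+ 2 + (y0 (tau (2 * S2)) ^+ 2 + y1 (tau (2 * S2)) ^+ 2)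
   <= u0 (tau s) ^+ 2 + u1 (tau s) ^+ 2 + (y0 (tau s) ^+ 2 + y1 (tau s) ^+ 2).
  move=> s1 s2; have hs : sh <= s by exact: le_trans s1.
  have /andP[_ tb] := tau_itv hs.
  have /andP[t0 _] := tau_itv (le_trans hs s2).
  have ts : tau (2 * S2) <= tau s.
    move: s2; rewrite le_eqVlt => /orP[/eqP->//|s2].
    by rewrite ltW// tau_decr.
  by have [hG hK] := mono _ _ t0 ts tb; lra.
have := @lower_phase _ X dX V dV S a1 a2 c1 c2 C ch sh r S1 S2 (2 * S2) _ _ _ _ rot
  shS1 SS1 S12 S23 S3r.
rewrite -/mu -/kap => H.
have {}H : expR (kap * Num.sqrt r * (V S2 - V S1)) <=
    3 * (u0 (tau S1) ^+ 2 + u1 (tau S1) ^+ 2 + (y0 (tau S1) ^+ 2 + y1 (tau S1) ^+ 2)).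
  rewrite -chirp_norm; apply: H.
  - move=> s hs; have := wr _ (tau_itv (ltW hs)).
    congr (0 <= _); rewrite -[LHS]mulr1 -(cos2Dsin2 (X s)); ring.
  - by move=> s s1 s2; rewrite !chirp_norm; exact: nrm.
  - rewrite chirp_norm.
    have h3 := tau_itv (le_trans shS1 (le_trans S12 S23)).
    have := row_second_entry_ge1 sol (ltW r0) init h3.
    have := sqr_ge0 (u0 (tau (2 * S2))); have := sqr_ge0 (y0 (tau (2 * S2))).
    lra.
  - exact: gap.
have /andP[t10 t1b] := tau_itv shS1.
have [mG mK] := mono _ _ t10 t1b (lexx b).
have Nb := row_norm_le sol (ltW r0) init ge0b.
pose F := Num.sqrt r * V r.
have x0 : 0 < Num.sqrt r by rewrite sqrtr_gt0.
have VS2 : V (2 * S1) <= V S2.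
  by apply: (chirp_V_ndecr ch) => //; apply: (le_trans SS1); lra.
have dV12 : del * V S2 <= V S2 - V S1.
  rewrite /del mulrBl mul1r lerD2l lerN2 mulrAC ler_pdivlMr ?(lt_trans VS1)//.
  by apply: ler_wpM2l => //; exact: ltW.
have VrD : V r / D <= V S2.
  rewrite ler_pdivrMr//.
  have := chirp_doubling (le_trans SS1 S12) S2r.
  have -> // : (r - S2) / S2 = th.
  by rewrite /S2 /th; field; rewrite !lt0r_neq0.
have F2 : 2 * cl * F <= kap * Num.sqrt r * (V S2 - V S1).
  have -> : 2 * cl * F = kap * Num.sqrt r * (del * (V r / D)).
    by rewrite /cl /F; field; exact: lt0r_neq0.
  apply: ler_wpM2l; first by rewrite mulr_ge0 ?ltW.
  by apply: le_trans dV12; apply: ler_wpM2l => //; exact: ltW.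
pose Kb := u1 b ^+ 2 + y1 b ^+ 2.
have Kb0 : 0 <= Kb by rewrite addr_ge0 ?sqr_ge0.
have h1 : expR (2 * cl * F) <= 3 * ((1 + r ^+ 2 * expR b) * Kb).
  apply: (@le_trans _ _ (expR (kap * Num.sqrt r * (V S2 - V S1)))).
    by rewrite ler_expR.
  apply: (le_trans H); apply: ler_wpM2l => //; rewrite /Kb; lra.
have h2 : 3 * (1 + r ^+ 2 * expR b) <= expR (cl * F).
  apply: (@le_trans _ _ (6 * expR b * r ^+ 2)).
    have : 1 <= r ^+ 2 * expR b.
      rewrite -[leLHS]mul1r; apply: ler_pM => //; first by rewrite exprn_ege1.
      by rewrite -expR0 ler_expR.
    lra.
  apply: (le_trans (poly _ r2r)); rewrite ler_expR -mulrA; apply: ler_wpM2l.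
    exact: ltW.
  rewrite mulrC; apply: ler_wpM2l; first exact: ltW.
  exact: (chirp_V_ndecr ch (lexx S) (le_trans SS1 (le_trans S12 S2r))).
rewrite -/F -/Kb -(ler_pM2l (expR_gt0 (cl * F))) -expRD.
have -> : cl * F + cl * F = 2 * cl * F by ring.
apply: (le_trans h1); rewrite mulrA; exact: ler_wpM2r.
Qed.

End Assembly.

(** * The integral from 1 as a function of its upper limit *)

Section Integral.
Context {R : realType}.
Variable w : R -> R.
Hypothesis cw : continuous (fun s : R => w (Num.max 1 s)).

Let wh s := w (Num.max 1 s).

(** The clamped integrand is continuous on the whole line, which puts the fundamental theorem of
    calculus within reach, and the integral over $[1,r]$ is unchanged. *)
Lemma int1_clamp r : int1 w r = parameterized_integral lebesgue_measure 1 r wh.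
Proof.
rewrite /int1 /parameterized_integral set_itvcc; apply: eq_Rintegral => s.
by rewrite inE /= => /andP[s1 _]; rewrite /wh max_r.
Qed.

Lemma int1_integrable (u : R) :
  lebesgue_measure.-integrable `[1, u] (EFin \o wh).
Proof.
apply: continuous_compact_integrable; first exact: segment_compact.
exact: continuous_subspaceT.
Qed.

Lemma int11 : int1 w 1 = 0.
Proof.
by rewrite int1_clamp /parameterized_integral set_itv1 Rintegral_set1.
Qed.

Lemma is_derive_int1 (s : R) : 1 < s -> is_derive s 1 (int1 w) (w s).
Proof.
move=> s1; have su : s < s + 1 by rewrite ltrDl ltr01.
have [d e] := continuous_FTC1_closed su (int1_integrable (s + 1)) s1 (@cw s).
have -> : int1 w = fun r => parameterized_integral lebesgue_measure 1 r wh.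
  by apply/funext => r; exact: int1_clamp.
split; first exact: d.
by rewrite -derive1E e /wh max_r// ltW.
Qed.

Lemma continuous_int1 : continuous (fun s : R => int1 w (Num.max 1 s)).
Proof.
move=> x; pose u := Num.max 1 x + 1.
have u1 : 1 <= u by rewrite /u; have : 1 <= Num.max 1 x by [rewrite le_max lexx]; lra.
have xu : x < u.
  by have : x <= Num.max 1 x by [rewrite le_max lexx orbT]; rewrite /u; lra.
have := parameterized_integral_continuous u1 (int1_integrable u).
rewrite set_itvcc => /(clamp_continuous u1) /(_ x).
have near_eq y : y < u -> parameterized_integral lebesgue_measure 1 (Num.max 1 (Num.min y u)) wh
   = int1 w (Num.max 1 y).
  by move=> yu; rewrite int1_clamp min_l// ltW.
rewrite /continuous_at near_eq// => H; apply: cvg_trans H; apply: near_eq_cvg.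
near=> y; apply: near_eq; near: y; exact: lt_nbhsl.
Unshelve. all: end_near. Qed.

End Integral.

(** * Smooth variation through the logarithmic derivative *)

Section SmoothVariation.
Context {R : realType}.
Variables (f : R -> R) (a : R).
Hypothesis sv : smoothly_varying f a.

(** By the chain rule this is $sf'(s)/f(s)$, the derivative of $\log f(e^x)$ at $x=\ln s$; it tends
    to the index. *)
Let ell s := derive1 (fun y => ln (f (expR y))) (ln s).

Lemma smoothly_varying_derive (s : R) : 1 < s -> is_derive s 1 f (f s / s * ell s).
Proof.
move=> s1; have s0 : 0 < s by exact: lt_trans s1.
case: sv => f0 [_ [dq _]].
have := dq 0%N (ln s) (ln_gt0 s1) => /derivableP dl.
have dc := is_derive_compf dl (is_derive1_ln s0).
apply: (@locally_eq_is_derive _ (fun t => expR (ln (f (expR (ln t))))) _ _ _ 1 (s + 1)).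
- by rewrite s1 ltrDl ltr01.
- move=> t /andP[t1 _]; have t0 : 0 < t by exact: lt_trans t1.
  by rewrite lnK ?posrE// lnK ?posrE// f0// ltW.
- have := is_derive_compf (is_derive_expR _) dc.
  rewrite /= lnK ?posrE// lnK ?posrE ?f0 ?ltW// => h.
  eapply is_derive_eq; first exact: h.
  by rewrite /ell derive1E; ring.
Qed.

Lemma smoothly_varying_bounds (e : R) : 0 < e -> exists2 T, 1 < T &
  forall s, T <= s -> a - e <= ell s <= a + e.
Proof.
move=> e0; case: sv => _ [_ [_ [+ _]]] => /cvgrPdist_lt /(_ e e0) [M [_ HM]].
exists (expR (Num.max 1 (M + 1))); first by rewrite expR_gt1 lt_max ltr01.
move=> s sM; have s0 : 0 < s by exact: lt_le_trans (expR_gt0 _) sM.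
have /HM : M < ln s.
  apply: (@lt_le_trans _ _ (M + 1)); first by rewrite ltrDl ltr01.
  apply: (@le_trans _ _ (Num.max 1 (M + 1))); first by rewrite le_max lexx orbT.
  by rewrite -[leLHS]expRK ler_ln// posrE expR_gt0.
by rewrite /ell ltr_norml => /andP[h1 h2]; apply/andP; split; lra.
Qed.

End SmoothVariation.

(** * Case 1: $X=f$ and $V=f/\sqrt s$ *)

Section Case1.
Context {R : realType}.
Variables (f : R -> R) (a : R).
Hypothesis f_incr : forall x y : R, 1 <= x -> x < y -> f x < f y.
Hypothesis sv : smoothly_varying f a.
Hypothesis ha : 1 / 2 < a < 1.
Hypothesis f_unbounded : forall y : R, exists2 s : R, 1 <= s & y <= f s.

Let X s := f (Num.max 1 s).
Let V s := X s * (Num.sqrt (Num.max 1 s))^-1.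

(** $V'=(\ell-\frac12)X/s^{3/2}$ with $\ell=sX'/X$: an index above $\frac12$ gives $c_1>0$, and an
    index below 1 gives $a_2<1$. *)
Lemma chirp_case1 : exists dX dV S a1 a2 c1 c2 C,
  chirp X dX V dV S a1 a2 c1 c2 C /\
  (forall r, S <= r -> f r = Num.sqrt r * V r).
Proof.
have /andP[ha1 ha2] := ha.
(* This tolerance keeps $a-e>\frac12$ and $a+e<1$. *)
pose e := Num.min ((a - 1 / 2) / 2) ((1 - a) / 2).
have e0 : 0 < e by rewrite lt_min !divr_gt0 ?subr_gt0.
have e1 : e <= (a - 1 / 2) / 2 by rewrite ge_min lexx.
have e2 : e <= (1 - a) / 2 by rewrite ge_min lexx orbT.
have [T T1 HT] := smoothly_varying_bounds sv e0.
pose ell (s : R) : R := derive1 (fun y => ln (f (expR y))) (ln s).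
pose dX (s : R) : R := f s / s * ell s.
pose dV (s : R) : R := dX s * (Num.sqrt s)^-1 - f s / (2 * (s * Num.sqrt s)).
have XE (s : R) : 1 <= s -> X s = f s by move=> s1; rewrite /X max_r.
have fd (s : R) : 1 < s -> is_derive s 1 f (dX s).
  by move=> s1; exact: (smoothly_varying_derive sv s1).
have f0 (s : R) : 1 <= s -> 0 < f s by case: sv => f0 _; exact: f0.
have Xd (s : R) : 1 < s -> is_derive s 1 X (dX s).
  move=> s1; apply: (@locally_eq_is_derive _ f _ _ _ 1 (s + 1)); last exact: fd.
  - by rewrite s1 ltrDl ltr01.
  - by move=> y /andP[y1 _]; rewrite XE// ltW.
have cX : continuous X.
  by apply: clamp_continuousy; case: sv => _ [].
have sqrt0 (s : R) : 1 <= s -> 0 < Num.sqrt s.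
  by move=> s1; rewrite sqrtr_gt0 (lt_le_trans ltr01).
exists dX, dV, T, (a - e), (a + e), (a - e - 1 / 2), (a + e - 1 / 2), 1.
have VE r : 1 <= r -> X r = Num.sqrt r * V r.
  by move=> r1; rewrite /V max_r// mulrCA mulfV ?mulr1// gt_eqF// sqrt0.
split; last first.
  by move=> r Tr; rewrite -VE ?XE// (le_trans _ Tr)// ltW.
have dVE (s : R) : 1 < s -> dV s = (ell s - 1 / 2) * (X s / (s * Num.sqrt s)).
  move=> s1; rewrite /dV /dX XE ?ltW//; field.
  by rewrite !gt_eqF ?sqrt0 ?ltW// (lt_trans _ s1).
have T_gt1 (s : R) : T <= s -> 1 < s by exact: lt_le_trans.
have pos (s : R) : 1 < s -> 0 <= X s / s.
  by move=> s1; rewrite divr_ge0 ?XE ?ltW ?f0 ?ltW// (lt_trans _ s1).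
have pos2 (s : R) : 1 < s -> 0 <= X s / (s * Num.sqrt s).
  move=> s1; rewrite invfM mulrA divr_ge0 ?pos//; exact: sqrtr_ge0.
split.
- exact: T1.
- lra.
- lra.
- lra.
- exact: cX.
- apply: continuous_mulf => //; apply: continuous_invf.
    apply: (continuous_compf (@sqrt_continuous R)); exact: continuous_max_cst.
  by move=> s; rewrite gt_eqF// sqrt0// le_max lexx.
- by move=> s s1; rewrite XE// ltW// f0.
- by move=> s s1; rewrite XE ?f0// ltW.
- exact: Xd.
(* [ell] is controlled only from [T] on, so for all $s>1$ the sign of $X'$ is taken from the
   monotonicity of [f]. *)
- move=> s s1; have -> : dX s = derive1 f s.
    by rewrite derive1E; have [_ ->] := fd _ s1.
  apply: (@incr_derive1_ge0_itvy _ f true 1).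
  + by move=> y; rewrite inE /= in_itv /= andbT => /fd [].
  + move=> y z; rewrite !in_itv /= !andbT => y1 _ yz; exact: f_incr.
  + by rewrite in_itv /= andbT.
- move=> s Ts; have /andP[h _] := HT _ Ts.
  have s1 := T_gt1 _ Ts; rewrite /dX -(XE _ (ltW s1)) mulrC.
  by apply: ler_wpM2l => //; exact: pos.
- move=> s Ts; have /andP[_ h] := HT _ Ts.
  have s1 := T_gt1 _ Ts; rewrite /dX -(XE _ (ltW s1)) [leRHS]mulrC.
  by apply: ler_wpM2l => //; exact: pos.
- move=> s Ts; have s1 := T_gt1 _ Ts; have s0 : 0 < s by exact: lt_trans s1.
  have y0 := sqrt0 _ (ltW s1).
  apply: (@locally_eq_is_derive _ (fun t => f t * (Num.sqrt t)^-1) _ _ _ 1 (s + 1)).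
  + by rewrite s1 ltrDl ltr01.
  + by move=> y /andP[y1 _]; rewrite /V XE ?max_r ?ltW.
  + have d1 := fd _ s1.
    have d2 := is_derive_invf (lt0r_neq0 y0) (is_derive1_sqrt s0).
    eapply is_derive_eq; first exact: (is_derive_mulf d1 d2).
    rewrite (sqr_sqrtr (ltW s0)) /dV; field.
    by rewrite !lt0r_neq0.
- move=> s Ts; have s1 := T_gt1 _ Ts; have /andP[h _] := HT _ Ts.
  by rewrite dVE//; apply: ler_wpM2r; [exact: pos2|rewrite lerD2r].
- move=> s Ts; have s1 := T_gt1 _ Ts; have /andP[_ h] := HT _ Ts.
  by rewrite dVE//; apply: ler_wpM2r; [exact: pos2|rewrite lerD2r].
- rewrite /V mulr_gt0 ?invr_gt0 ?sqrt0 ?XE ?f0 ?ltW//.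
  by rewrite max_r// ltW.
- by move=> s Ts; rewrite mul1r -VE// ltW// T_gt1.
- by move=> y; have [s s1 ys] := f_unbounded y; exists s => //; rewrite XE.
Qed.

End Case1.

(** * Case 2: $X=h$ and $V=\int v$, related by $V'=X'/\sqrt s$ *)

Section Case2.
Context {R : realType}.
Variables (v : R -> R).
Hypothesis sv : smoothly_varying v (-1).
Let h := int1 (fun s => Num.sqrt s * v s).
Hypothesis h_unbounded : forall y : R, exists2 s : R, 1 <= s & y <= h s.

Let X s := h (Num.max 1 s).
Let V s := int1 v (Num.max 1 s).
Let dX (s : R) : R := Num.sqrt s * v s.

Let v0 (s : R) : 1 <= s -> 0 < v s.
Proof. by case: sv => v0 _; exact: v0. Qed.

Let sqrt0 (s : R) : 1 <= s -> 0 < Num.sqrt s.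
Proof. by move=> s1; rewrite sqrtr_gt0 (lt_le_trans ltr01). Qed.

Let cv : continuous (fun s : R => v (Num.max 1 s)).
Proof. by apply: clamp_continuousy; case: sv => _ []. Qed.

Let cdX : continuous (fun s : R => dX (Num.max 1 s)).
Proof.
apply: continuous_mulf => //.
apply: (continuous_compf (@sqrt_continuous R)); exact: continuous_max_cst.
Qed.

Let cX : continuous X.
Proof. exact: (continuous_int1 cdX). Qed.

Let cV : continuous V.
Proof. exact: (continuous_int1 cv). Qed.

Let Xd (s : R) : 1 < s -> is_derive s 1 X (dX s).
Proof.
move=> s1; apply: (@locally_eq_is_derive _ h _ _ _ 1 (s + 1)).
- by rewrite s1 ltrDl ltr01.
- by move=> y /andP[y1 _]; rewrite /X max_r// ltW.
- exact: (is_derive_int1 cdX).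
Qed.

Let Vd (s : R) : 1 < s -> is_derive s 1 V (v s).
Proof.
move=> s1; apply: (@locally_eq_is_derive _ (int1 v) _ _ _ 1 (s + 1)).
- by rewrite s1 ltrDl ltr01.
- by move=> y /andP[y1 _]; rewrite /V max_r// ltW.
- exact: (is_derive_int1 cv).
Qed.

Lemma case2_incr (s t : R) : 1 <= s -> s < t -> h s < h t.
Proof.
move=> s1 st; have t1 : 1 <= t by rewrite ltW// (le_lt_trans s1).
have XE y : 1 <= y -> h y = X y by move=> y1; rewrite /X max_r.
rewrite !XE//; apply: (@derive_gt0_incr _ X dX) => // y /andP[sy _].
  by apply: Xd; exact: le_lt_trans sy.
have y1 : 1 <= y by rewrite (le_trans s1)// ltW.
by rewrite mulr_gt0 ?sqrt0 ?v0.
Qed.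

Let X1 : X 1 = 0. Proof. by rewrite /X maxxx /h int11. Qed.
Let V1 : V 1 = 0. Proof. by rewrite /V maxxx int11. Qed.

Let X_incr (s t : R) : 1 <= s -> s < t -> X s < X t.
Proof.
move=> s1 st; have t1 : 1 <= t by rewrite ltW// (le_lt_trans s1).
by rewrite /X !max_r//; exact: case2_incr.
Qed.

Let X_ndecr (s t : R) : 1 <= s -> s <= t -> X s <= X t.
Proof.
by move=> s1; rewrite le_eqVlt => /orP[/eqP->//|st]; rewrite ltW// X_incr.
Qed.

Let V_gt0 (s : R) : 1 < s -> 0 < V s.
Proof.
move=> s1; rewrite -V1; apply: (@derive_gt0_incr _ V v) => // y /andP[y1 _].
  exact: Vd.
by rewrite v0// ltW.
Qed.

(** $(\sqrt s\,V-X)'=V/(2\sqrt s)\ge0$, since the terms $\sqrt s\,v$ cancel, and the difference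
    vanishes at 1. *)
Let X_le (s : R) : 1 <= s -> X s <= Num.sqrt s * V s.
Proof.
move=> s1; rewrite -subr_ge0.
have -> : 0 = Num.sqrt 1 * V 1 - X 1 by rewrite V1 X1 mulr0 subr0.
apply: (@derive_ge0_ndecr _ (fun y => Num.sqrt y * V y - X y)
  (fun y => (2 * Num.sqrt y)^-1 * V y)) => //.
- apply: continuous_addf; last exact: continuous_oppf.
  by apply: continuous_mulf => //; exact: sqrt_continuous.
- move=> y /andP[y1 _]; have y0 : 0 < y by exact: lt_trans y1.
  have := is_derive1_sqrt y0; have := Vd y1; have := Xd y1 => d1 d2 d3.
  eapply is_derive_eq.
    exact: (is_derive_addf (is_derive_mulf d3 d2) (is_derive_oppf d1)).
  by rewrite /dX; ring.
- move=> y /andP[y1 _]; rewrite mulr_ge0 ?invr_ge0 ?mulr_ge0 ?sqrtr_ge0//.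
  by rewrite ltW// V_gt0.
Qed.

(* Karamata: [u s = s^(3/2) v s] satisfies [u' = (3/2 + ell) X'] with
   [ell --> -1], so [u / X] is eventually close to [1/2]. *)
Lemma case2_karamata : exists2 S : R, 1 < S & forall s : R, S <= s ->
  1 / 8 * X s <= s * dX s <= 7 / 8 * X s.
Proof.
(* The tolerance puts $\frac32+\ell$ into $[\frac14,\frac34]$. *)
have e0 : 0 < 1 / 4 :> R by rewrite divr_gt0.
have [T T1 HT] := smoothly_varying_bounds sv e0.
pose ell (s : R) : R := derive1 (fun y => ln (v (expR y))) (ln s).
pose u (s : R) : R := s * dX (Num.max 1 s).
have cu : continuous u by apply: continuous_mulf => //; exact: continuous_idf.
have ud (s : R) : 1 < s -> is_derive s 1 u ((3 / 2 + ell s) * dX s).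
  move=> s1; have s0 : 0 < s by exact: lt_trans s1.
  apply: (@locally_eq_is_derive _ (fun y => y * (Num.sqrt y * v y)) _ _ _ 1 (s + 1)).
  - by rewrite s1 ltrDl ltr01.
  - by move=> y /andP[y1 _]; rewrite /u /dX max_r// ltW.
  - have d1 := smoothly_varying_derive sv s1; have d2 := is_derive1_sqrt s0.
    eapply is_derive_eq.
      exact: (is_derive_mulf (is_derive_idf s) (is_derive_mulf d2 d1)).
    rewrite -/(ell s) /dX.
    have ss : s = Num.sqrt s ^+ 2 by rewrite sqr_sqrtr// ltW.
    have y0 : Num.sqrt s != 0 by rewrite gt_eqF// sqrt0// ltW.
    move: ss y0; move: (Num.sqrt s) (ell s) (v s) => y l w ss y0.
    by rewrite ss; field.
have dX0 (s : R) : 1 < s -> 0 < dX s by move=> s1; rewrite mulr_gt0 ?sqrt0 ?v0// ltW.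
have lower (s : R) : T <= s -> u T - 1 / 4 * X T <= u s - 1 / 4 * X s.
  move=> Ts; apply: (@derive_ge0_ndecr _ (fun y => u y - 1 / 4 * X y)
    (fun y => (3 / 2 + ell y) * dX y - 1 / 4 * dX y)) => //.
  - continuous_tac.
  - move=> y /andP[Ty _]; have y1 : 1 < y by exact: lt_trans Ty.
    have := ud _ y1; have := Xd y1 => ? ?.
    eapply is_derive_eq; first is_derive_tac.
    rewrite /GRing.scale /=; ring.
  - move=> y /andP[Ty _]; have y1 : 1 < y by exact: lt_trans Ty.
    have /andP[l1 l2] := HT _ (ltW Ty).
    rewrite -mulrBl mulr_ge0 ?(ltW (dX0 _ y1))//; rewrite -/(ell y) in l1 l2; lra.
have upper (s : R) : T <= s -> u s - 3 / 4 * X s <= u T - 3 / 4 * X T.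
  move=> Ts; apply: (@derive_le0_nincr _ (fun y => u y - 3 / 4 * X y)
    (fun y => (3 / 2 + ell y) * dX y - 3 / 4 * dX y)) => //.
  - continuous_tac.
  - move=> y /andP[Ty _]; have y1 : 1 < y by exact: lt_trans Ty.
    have := ud _ y1; have := Xd y1 => ? ?.
    eapply is_derive_eq; first is_derive_tac.
    rewrite /GRing.scale /=; ring.
  - move=> y /andP[Ty _]; have y1 : 1 < y by exact: lt_trans Ty.
    have /andP[l1 l2] := HT _ (ltW Ty).
    rewrite -mulrBl mulr_le0_ge0 ?(ltW (dX0 _ y1))//; rewrite -/(ell y) in l1 l2; lra.
have uT0 : 0 < u T.
  by rewrite /u (max_r (ltW T1)) mulr_gt0 ?dX0// (lt_trans _ T1).
have XT0 : 0 < X T by rewrite -X1 X_incr.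
(* Integration leaves constants at [T]: $X\ge8u(T)$ turns $\frac34$ into $\frac78$, and $X\ge2X(T)$
   turns $\frac14$ into $\frac18$. *)
have [s0 s01 hs0] := h_unbounded (2 * X T + 8 * u T).
exists (Num.max T s0); first by rewrite lt_max T1.
move=> s; rewrite ge_max => /andP[Ts s0s].
have s1 : 1 < s by exact: lt_le_trans T1 Ts.
have Xs : 2 * X T + 8 * u T <= X s.
  have XE0 : X s0 = h s0 by rewrite /X max_r.
  by apply: (le_trans hs0); rewrite -XE0 X_ndecr.
have usE : u s = s * dX s by rewrite /u max_r// ltW.
have := lower _ Ts; have := upper _ Ts.
rewrite usE => hu hl; apply/andP; split; lra.
Qed.

(** As $v=sX'/s^{3/2}$, the bounds on $sX'$ serve for $X'$ and for $V'$, hence the same two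
    constants twice. *)
Lemma chirp_case2 : exists dX dV S a1 a2 c1 c2 C,
  chirp X dX V dV S a1 a2 c1 c2 C.
Proof.
have [S S1 HS] := case2_karamata.
exists dX, v, S, (1 / 8), (7 / 8), (1 / 8), (7 / 8), 1.
have S_gt1 (s : R) : S <= s -> 1 < s by exact: lt_le_trans.
have S_gt0 (s : R) : S <= s -> 0 < s by move=> /S_gt1; exact: lt_trans.
have vE (s : R) : S <= s -> v s = s * dX s / (s * Num.sqrt s).
  move=> Ss; rewrite /dX; field.
  by rewrite !gt_eqF ?sqrt0 ?S_gt0// ltW// S_gt1.
have p0 (s : R) : S <= s -> 0 <= (s * Num.sqrt s)^-1.
  by move=> Ss; rewrite invr_ge0 mulr_ge0 ?sqrtr_ge0// ltW// S_gt0.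
split.
- exact: S1.
- lra.
- lra.
- lra.
- exact: cX.
- exact: cV.
- by move=> s s1; rewrite -X1 X_ndecr.
- by move=> s s1; rewrite -X1 X_incr.
- exact: Xd.
- by move=> s s1; rewrite mulr_ge0 ?sqrtr_ge0// ltW// v0// ltW.
- move=> s Ss; have /andP[h1 _] := HS _ Ss.
  by rewrite mulrA ler_pdivrMr ?S_gt0// [leRHS]mulrC.
- move=> s Ss; have /andP[_ h2] := HS _ Ss.
  by rewrite mulrA ler_pdivlMr ?S_gt0// mulrC.
- by move=> s /S_gt1; exact: Vd.
- move=> s Ss; have /andP[h1 _] := HS _ Ss.
  by rewrite [leRHS]vE// mulrA; apply: ler_wpM2r => //; exact: p0.
- move=> s Ss; have /andP[_ h2] := HS _ Ss.
  by rewrite [leLHS]vE// mulrA; apply: ler_wpM2r => //; exact: p0.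
- exact: V_gt0 S1.
- by move=> s /S_gt1 s1; rewrite mul1r X_le// ltW.
- by move=> y; have [s s1 ys] := h_unbounded y; exists s => //; rewrite /X max_r.
Qed.

End Case2.

(** * Complex matrices in real coordinates; rows of the fundamental solution *)

Section ComplexSystem.
Context {R : realType}.
Implicit Types (A : 'M[R[i]]_2) (x z : R[i]).

Definition abs2 (x : R[i]) : R := complex.Re x ^+ 2 + complex.Im x ^+ 2.

Lemma abs2_ge0 x : 0 <= abs2 x.
Proof. by rewrite addr_ge0// sqr_ge0. Qed.

Lemma sqr_cabs x : cabs x ^+ 2 = abs2 x.
Proof. by rewrite sqr_sqrtr// abs2_ge0. Qed.

(** Lagrange's identity: the defect is $|a_0\overline{v_1}-a_1\overline{v_0}|^2$. *)
Lemma abs2_cauchy (a0 a1 v0 v1 : R[i]) :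
  abs2 (a0 * v0 + a1 * v1) <= (abs2 a0 + abs2 a1) * (abs2 v0 + abs2 v1).
Proof.
case: a0 => p0 q0; case: a1 => p1 q1; case: v0 => s0 t0; case: v1 => s1 t1.
rewrite /abs2 /= -subr_ge0.
set d := (X in 0 <= X).
have -> : d = (p0 * s1 + q0 * t1 - (p1 * s0 + q1 * t0)) ^+ 2 +
              (q0 * s1 - p0 * t1 - (q1 * s0 - p1 * t0)) ^+ 2 by rewrite /d; ring.
by rewrite addr_ge0// sqr_ge0.
Qed.

Lemma vnorm_mulmx_le A M (v : 'cV[R[i]]_2) :
  (forall i, abs2 (A i ord0) + abs2 (A i ord_max) <= M) -> vnorm v = 1 ->
  vnorm (A *m v) <= Num.sqrt (2 * M).
Proof.
move=> AM v1; rewrite /vnorm !sqr_cabs; apply: ler_wsqrtr.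
have {}v1 : abs2 (v ord0 ord0) + abs2 (v ord_max ord0) = 1.
  have := congr1 (fun y => y ^+ 2) v1.
  by rewrite /vnorm sqr_sqrtr ?addr_ge0 ?sqr_ge0// !sqr_cabs expr1n.
have row i : abs2 ((A *m v) i ord0) <= M.
  rewrite mxE big_ord_recl big_ord1.
  rewrite (_ : lift ord0 ord0 = ord_max :> 'I_2); last exact: val_inj.
  apply: (le_trans (abs2_cauchy _ _ _ _)).
  by rewrite v1 mulr1.
have := row ord0; have := row ord_max; lra.
Qed.

Lemma opnorm_set_nonempty A :
  [set vnorm (A *m v) | v in [set v | vnorm v = 1]] !=set0.
Proof.
exists (vnorm (A *m (delta_mx ord_max ord0))).
exists (delta_mx ord_max ord0) => //=.
rewrite /vnorm !sqr_cabs !mxE /= /abs2 /=.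
by rewrite !expr0n expr1n !addr0 add0r sqrtr1.
Qed.

Lemma opnorm_le A M :
  (forall i, abs2 (A i ord0) + abs2 (A i ord_max) <= M) ->
  opnorm A <= Num.sqrt (2 * M).
Proof.
move=> AM; apply: ge_sup; first exact: opnorm_set_nonempty.
by move=> _ [v v1 <-]; exact: vnorm_mulmx_le.
Qed.

(** The test vector $e_2$ picks the second column. [M] shows that the set is bounded above, so that
    its supremum dominates its members. *)
Lemma cabs_le_opnorm A : cabs (A ord_max ord_max) <= opnorm A.
Proof.
pose M := abs2 (A ord0 ord0) + abs2 (A ord0 ord_max) +
          (abs2 (A ord_max ord0) + abs2 (A ord_max ord_max)).
have AM i : abs2 (A i ord0) + abs2 (A i ord_max) <= M.
  have [->|->] : i = ord0 \/ i = ord_max.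
    by case: i => [[|[|//]] h]; [left|right]; exact: val_inj.
  - by rewrite lerDl addr_ge0 ?abs2_ge0.
  - by rewrite lerDr addr_ge0 ?abs2_ge0.
pose e : 'cV[R[i]]_2 := delta_mx ord_max ord0.
have e1 : vnorm e = 1.
  rewrite /vnorm !sqr_cabs !mxE /= /abs2 /=.
  by rewrite !expr0n expr1n !addr0 add0r sqrtr1.
apply: (@le_trans _ _ (vnorm (A *m e))).
  rewrite /e -colE /vnorm !mxE !sqr_cabs; apply: ler_wsqrtr.
  by rewrite lerDr abs2_ge0.
apply: ub_le_sup; last by exists e.
by exists (Num.sqrt (2 * M)) => _ [v v1 <-]; exact: vnorm_mulmx_le.
Qed.

(** A row $(d_0,d_1)$ of $D$ becomes $(d_1,-d_0)$ in $DJ$; the hypotheses are its two entries in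
    $DJ=zWH$ with $H=\xi\xi^T$. *)
Lemma row_entry_derivatives (z w0 w1 d0 d1 : R[i]) (c s : R) :
  d1 = z * (w0 * ((c * c)%:C)%C + w1 * ((s * c)%:C)%C) ->
  - d0 = z * (w0 * ((c * s)%:C)%C + w1 * ((s * s)%:C)%C) ->
  let re := complex.Re z * (complex.Re w0 * c + complex.Re w1 * s)
          - complex.Im z * (complex.Im w0 * c + complex.Im w1 * s) in
  let im := complex.Re z * (complex.Im w0 * c + complex.Im w1 * s)
          + complex.Im z * (complex.Re w0 * c + complex.Re w1 * s) in
  [/\ complex.Re d0 = - (re * s), complex.Re d1 = re * c,
      complex.Im d0 = - (im * s) & complex.Im d1 = im * c].
Proof.
move=> -> /eqP; rewrite eqr_oppLR => /eqP ->.
case: z => a b; case: w0 => p0 q0; case: w1 => p1 q1 /=.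
by split; ring.
Qed.

Section Row.
Variables (phi : R -> R) (b : R) (W : R -> R[i] -> 'M[R[i]]_2).
Hypothesis b0 : 0 < b.
Hypothesis fs : fundamental_solution (Hmat phi) b W.

(** [W] is known to be continuous on $[0,b]$ only. [cl] extends it by constants, leaving the
    equation on $(0,b)$ and both end values intact. *)
Let cl t := Num.max 0 (Num.min t b).

Lemma fundamental_row (z : R[i]) (i : 'I_2) :
  row_solution phi b (complex.Re z) (complex.Im z)
    (fun t => complex.Re (W (cl t) z i ord0))
    (fun t => complex.Re (W (cl t) z i ord_max))
    (fun t => complex.Im (W (cl t) z i ord0))
    (fun t => complex.Im (W (cl t) z i ord_max)).
Proof.
have [W0 [Wc Wd]] := fs z.
have clE t : 0 < t < b -> cl t = t.
  by move=> /andP[t0 tb]; rewrite /cl min_l ?max_r// ltW.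
have key t : 0 < t < b ->
  [/\ is_derive t 1 (fun t => complex.Re (W (cl t) z i ord0))
    (- ((complex.Re z * (complex.Re (W t z i ord0) * cos (phi t) + complex.Re (W t z i ord_max) * sin (phi t))
       - complex.Im z * (complex.Im (W t z i ord0) * cos (phi t) + complex.Im (W t z i ord_max) * sin (phi t))) * sin (phi t))),
     is_derive t 1 (fun t => complex.Re (W (cl t) z i ord_max))
    ((complex.Re z * (complex.Re (W t z i ord0) * cos (phi t) + complex.Re (W t z i ord_max) * sin (phi t))
       - complex.Im z * (complex.Im (W t z i ord0) * cos (phi t) + complex.Im (W t z i ord_max) * sin (phi t))) * cos (phi t)),
     is_derive t 1 (fun t => complex.Im (W (cl t) z i ord0))
    (- ((complex.Re z * (complex.Im (W t z i ord0) * cos (phi t) + complex.Im (W t z i ord_max) * sin (phi t))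
       + complex.Im z * (complex.Re (W t z i ord0) * cos (phi t) + complex.Re (W t z i ord_max) * sin (phi t))) * sin (phi t))) &
     is_derive t 1 (fun t => complex.Im (W (cl t) z i ord_max))
    ((complex.Re z * (complex.Im (W t z i ord0) * cos (phi t) + complex.Im (W t z i ord_max) * sin (phi t))
       + complex.Im z * (complex.Re (W t z i ord0) * cos (phi t) + complex.Re (W t z i ord_max) * sin (phi t))) * cos (phi t))].
  move=> tb; have [D [Dd DJ]] := Wd t tb.
  have l01 : lift ord0 ord0 = ord_max :> 'I_2 by exact: val_inj.
  have e j : (D *m Jmat R) i j = z * (W t z i ord0 * Hmat phi t ord0 j +
      W t z i ord_max * Hmat phi t ord_max j).
    by rewrite DJ mxE [X in _ * X = _]mxE big_ord_recl big_ord1 l01.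
  have e0 := e ord0; have e1 := e ord_max.
  rewrite !mxE !big_ord_recl !big_ord0 l01 !mxE /= !addr0 in e0 e1.
  rewrite !mulr0 mulr1 add0r in e0.
  rewrite mulr0 addr0 mulrN1 in e1.
  have [h0 h1 h2 h3] := row_entry_derivatives e0 e1.
  have [r0 i0] := Dd i ord0; have [r1 i1] := Dd i ord_max.
  rewrite h0 in r0; rewrite h1 in r1; rewrite h2 in i0; rewrite h3 in i1.
  by split; [apply: (locally_eq_is_derive tb _ r0)|apply: (locally_eq_is_derive tb _ r1)
    |apply: (locally_eq_is_derive tb _ i0)|apply: (locally_eq_is_derive tb _ i1)];
    move=> y yb; rewrite clE.
split.
- exact: (clamp_continuous (ltW b0) (Wc i ord0).1).
- exact: (clamp_continuous (ltW b0) (Wc i ord_max).1).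
- exact: (clamp_continuous (ltW b0) (Wc i ord0).2).
- exact: (clamp_continuous (ltW b0) (Wc i ord_max).2).
- by move=> t tb; rewrite clE//; have [] := key _ tb.
- by move=> t tb; rewrite clE//; have [] := key _ tb.
- by move=> t tb; rewrite clE//; have [] := key _ tb.
- by move=> t tb; rewrite clE//; have [] := key _ tb.
Qed.

End Row.
End ComplexSystem.

(** * From row bounds to the monodromy matrix *)

Section Asymptotics.
Context {R : realType}.
Variables (X dX V dV : R -> R) (S a1 a2 c1 c2 C : R).
Hypothesis ch : chirp X dX V dV S a1 a2 c1 c2 C.
Variables (tau phi f : R -> R) (sh b : R).
Hypothesis ctau : continuous tau.
Hypothesis tauE : forall s, 1 <= s -> tau s = X s / s.
Hypothesis sh1 : 1 <= sh.
Hypothesis Xsh_gt0 : 0 < X sh.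
Hypothesis tau_decr : forall s t, sh <= s -> s < t -> tau t < tau s.
Hypothesis bE : b = tau sh.
Hypothesis phi_tau : forall s, sh <= s -> phi (tau s) = X s.
Hypothesis fE : forall r, S <= r -> f r = Num.sqrt r * V r.
Variable W : R -> R[i] -> 'M[R[i]]_2.
Hypothesis fs : fundamental_solution (Hmat phi) b W.

Lemma monodromy_bounds : exists c K r0 : R, [/\ 0 < c, 0 < K &
  forall r, r0 <= r ->
    [/\ expR (c * f r) <= cabs (W b (Complex 0 r) ord_max ord_max),
        cabs (W b (Complex 0 r) ord_max ord_max) <= Mmax W b r &
        Mmax W b r <= expR (K * f r)] ].
Proof.
have b0 : 0 < b by rewrite bE (tau_gt0 ch tauE sh1 Xsh_gt0).
have [Cu [r1 [Cu0 up]]] :=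
  chirp_upper ch ctau tauE sh1 Xsh_gt0 tau_decr bE phi_tau.
have [cl [r2 [cl0 low]]] :=
  chirp_lower ch ctau tauE sh1 Xsh_gt0 tau_decr bE phi_tau.
have V0 := chirp_V_gt0 ch.
have cl00 : Num.max 0 (Num.min 0 b) = 0 by rewrite min_l ?maxxx// ltW.
have clbb : Num.max 0 (Num.min b b) = b by rewrite minxx max_r// ltW.
(* The row bounds concern squared moduli, hence the halves. The term $1/V(S)$ absorbs a factor
   $\sqrt2$ from the operator norm, since $f(r)\ge V(S)$ gives $e^{f(r)/V(S)}\ge e$. *)
exists (cl / 2), (Cu / 2 + 1 / V S), (Num.max S (Num.max r1 r2)).
split; [by rewrite divr_gt0|by rewrite addr_gt0 ?divr_gt0|].
move=> r; rewrite !ge_max => /and3P[Sr r1r r2r].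
have r_gt1 : 1 < r by exact: lt_le_trans (chirp_S ch) Sr.
have r0 : 0 < r by exact: lt_trans r_gt1.
have opn z : cabs z = r -> opnorm (W b z) <= expR ((Cu / 2 + 1 / V S) * f r).
  move=> zr.
  have acr : complex.Re z ^+ 2 + complex.Im z ^+ 2 = r ^+ 2.
    by rewrite -zr sqr_cabs.
  apply: (@le_trans _ _ (Num.sqrt (2 * expR (Cu * f r)))).
    apply: opnorm_le => i.
    have := up _ _ _ _ _ _ _ r1r acr (fundamental_row b0 fs z i).
    rewrite cl00 clbb -fE// => H.
    rewrite /abs2 addrACA; apply: H.
    have [-> _] := fs z.
    have [->|->] : i = ord0 \/ i = ord_max.
      by case: i => [[|[|//]] h]; [left|right]; exact: val_inj.
    - by rewrite !mxE /= !expr0n expr1n !addr0.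
    - by rewrite !mxE /= !expr0n expr1n !addr0 add0r.
  have F1 : 1 <= f r / V S.
    rewrite ler_pdivlMr// mul1r fE//.
    rewrite -[leLHS]mul1r; apply: ler_pM => //; first exact: ltW.
      by rewrite -sqrtr1 ler_wsqrtr// ltW.
    exact: (chirp_V_ndecr ch).
  have e2 : 2 <= expR (1 : R) ^+ 2.
    have := expR_ge1Dx (1 : R) => h.
    apply: le_trans (_ : (1 + 1) ^+ 2 <= _); first by rewrite expr2; lra.
    by rewrite ler_pXn2r// nnegrE ?expR_ge0.
  have -> : (Cu / 2 + 1 / V S) * f r = f r / V S + Cu * f r / 2 by ring.
  rewrite expRD; set y := expR (Cu * f r / 2).
  have yy : expR (Cu * f r) = y ^+ 2.
    by rewrite /y -expRM_natl; congr expR; field.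
  have y0 : 0 <= y by exact: expR_ge0.
  rewrite yy -[leRHS]ger0_norm ?mulr_ge0 ?expR_ge0// -sqrtr_sqr.
  apply: ler_wsqrtr; rewrite exprMn; apply: ler_wpM2r; first exact: sqr_ge0.
  apply: (le_trans e2).
  by rewrite ler_pXn2r// ?nnegrE ?expR_ge0// ler_expR.
have zr : cabs (Complex 0 r) = r.
  by rewrite /cabs /= expr0n add0r sqrtr_sqr ger0_norm// ltW.
split.
- have sol := fundamental_row b0 fs (Complex 0 r) ord_max.
  have := low _ _ _ _ _ r2r sol; rewrite cl00 clbb -fE// => H.
  have {}H : expR (cl * f r) <= abs2 (W b (Complex 0 r) ord_max ord_max).
    apply: H; have [-> _] := fs (Complex 0 r).
    by rewrite !mxE.
  rewrite /cabs -/(abs2 _).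
  apply: le_trans (ler_wsqrtr H).
  have -> : expR (cl * f r) = expR (cl / 2 * f r) ^+ 2.
    by rewrite -expRM_natl; congr expR; field.
  by rewrite sqrtr_sqr ger0_norm ?expR_ge0.
- apply: (le_trans (cabs_le_opnorm _)); apply: ub_le_sup; last by exists (Complex 0 r).
  by exists (expR ((Cu / 2 + 1 / V S) * f r)) => _ [z zr' <-]; exact: opn.
- apply: ge_sup; first by exists (opnorm (W b (Complex 0 r))), (Complex 0 r).
  by move=> _ [z zr' <-]; exact: opn.
Qed.

Lemma monodromy_asymp :
  asymp_large (fun r => ln (Mmax W b r)) f /\
  asymp_large (fun r => ln (cabs (W b (Complex 0 r) ord_max ord_max))) f.
Proof.
have [c [K [r0 [c0 K0 H]]]] := monodromy_bounds.
have lnle (x y : R) : 0 < x -> x <= y -> ln x <= ln y.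
  by move=> x0 xy; rewrite ler_ln// posrE// (lt_le_trans x0).
split; exists c, K, r0; split=> //; split=> // r rr0; have [h1 h2 h3] := H _ rr0.
- have e1 := expR_gt0 (c * f r); have e2 := lt_le_trans e1 h1.
  have e3 := lt_le_trans e2 h2.
  split.
    by rewrite -[leLHS]expRK; apply: lnle => //; exact: le_trans h2.
  by rewrite -[leRHS]expRK; exact: lnle.
- have e1 := expR_gt0 (c * f r); have e2 := lt_le_trans e1 h1.
  split.
    by rewrite -[leLHS]expRK; exact: lnle.
  by rewrite -[leRHS]expRK; apply: lnle => //; exact: le_trans h3.
Qed.

End Asymptotics.

(** * The function [g] and its inverse in terms of the parameter [s] *)

Section Inversion.
Context {R : realType}.
Variables (X0 finv g f : R -> R) (x0 : R).
Let X s := X0 (Num.max 1 s).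
Variables (dX V dV : R -> R) (S a1 a2 c1 c2 C : R).
Hypothesis ch : chirp X dX V dV S a1 a2 c1 c2 C.
Hypothesis fE : forall r, S <= r -> f r = Num.sqrt r * V r.
Hypothesis X0_incr : forall s t : R, 1 <= s -> s < t -> X0 s < X0 t.
Hypothesis finvP : forall x, x0 <= x -> 1 <= finv x /\ X0 (finv x) = x.
Hypothesis gE : forall x, g x = x / finv x.

Let tau (s : R) : R := X s * (Num.max 1 s)^-1.

Let XE (s : R) : 1 <= s -> X s = X0 s.
Proof. by move=> s1; rewrite /X max_r. Qed.

Let tauE (s : R) : 1 <= s -> tau s = X s / s.
Proof. by move=> s1; rewrite /tau max_r. Qed.

Let ctau : continuous tau.
Proof.
apply: continuous_mulf; first exact: chirp_cX ch.
apply: continuous_invf; first exact: continuous_max_cst.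
by move=> s; rewrite gt_eqF// lt_max ltr01.
Qed.

Let X0_inj (s t : R) : 1 <= s -> 1 <= t -> X0 s = X0 t -> s = t.
Proof.
move=> s1 t1 e; have [st|ts|//] := ltgtP s t.
  by have := X0_incr s1 st; rewrite e ltxx.
by have := X0_incr t1 ts; rewrite e ltxx.
Qed.

Let X0_le (s t : R) : 1 <= s -> 1 <= t -> X0 s <= X0 t -> s <= t.
Proof.
by move=> s1 t1; apply: contraTT; rewrite -!ltNge; exact: X0_incr.
Qed.

(** Strict monotonicity turns the given right inverse [finv] into a left inverse. *)
Let g_X0 (s : R) : 1 <= s -> x0 <= X0 s -> g (X0 s) = tau s.
Proof.
move=> s1 xs; have [f1 fX] := finvP xs.
by rewrite gE (X0_inj f1 s1 fX) tauE// XE.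
Qed.

Lemma tau_decr_chirp (s t : R) : S <= s -> s < t -> tau t < tau s.
Proof.
move=> Ss st; rewrite -ltrN2.
have gt1 y : S <= y -> 1 < y by exact: lt_le_trans (chirp_S ch).
apply: (@derive_gt0_incr _ (fun y => - tau y)
  (fun y => - (dX y / y - X y / y ^+ 2))) => //.
- exact: continuous_oppf.
- move=> y /andP[sy _]; have y1 : 1 < y by apply: gt1; rewrite (le_trans Ss)// ltW.
  exact: (is_derive_oppf (derive_tau ch tauE (lexx 1) y1)).
- move=> y /andP[sy _]; have Sy : S <= y by rewrite (le_trans Ss)// ltW.
  have y1 := gt1 _ Sy; have y0 : 0 < y by exact: lt_trans y1.
  have du := chirp_dX_le ch Sy.
  have X_gt0 := chirp_X_gt0 ch y1.
  have -> : - (dX y / y - X y / y ^+ 2) = (X y / y - dX y) / y.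
    by field; exact: lt0r_neq0.
  rewrite divr_gt0// subr_gt0; apply: (le_lt_trans du).
  by rewrite gtr_pMl ?(chirp_a2 ch)// divr_gt0.
Qed.

(** Gronwall with $\rho=a_2\ln s$ gives $X(s)\le X(S)(s/S)^{a_2}$, so $\tau$ decays at least like
    $s^{a_2-1}$. *)
Lemma tau_vanishes (e : R) : 0 < e -> exists2 T, S <= T & tau T < e.
Proof.
move=> e0; have S1 := chirp_S ch; have S0 : 0 < S by exact: lt_trans S1.
have a20 : 0 < 1 - a2 by rewrite subr_gt0 (chirp_a2 ch).
have X_gt0 := chirp_X_gt0 ch S1.
have cl : continuous (fun s : R => ln (Num.max 1 s)).
  move=> x.
  suff : {for x, continuous (@ln R \o (fun y : R => Num.max 1 y))} by [].
  apply: continuous_comp; first exact: continuous_max_cst.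
  by apply: continuous_ln; rewrite lt_max ltr01.
(* For $T=Se^m$ it is enough that $\exp((1-a_2)m)$ exceed [X S / e], and already $1+(1-a_2)m$
   does. *)
pose m := X S / (e * (1 - a2)).
have m0 : 0 < m by rewrite divr_gt0// mulr_gt0.
pose T := S * expR m.
have ST : S <= T by rewrite /T ler_peMr ?(ltW S0)// ltW// expR_gt1.
have T1 : 1 < T by exact: lt_le_trans ST.
exists T => //.
have := @gronwall _ X dX (fun s => a2 * ln (Num.max 1 s)) (fun s => a2 * s^-1)
  S T ST (chirp_cX ch).
rewrite (max_r (ltW S1)) (max_r (ltW T1)) /T lnM ?posrE ?expR_gt0// expRK.
rewrite -/T => H.
have {}H : X T <= X S * expR (a2 * m).
  have -> : a2 * m = a2 * (ln S + m) - a2 * ln S by ring.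
  apply: H.
  - by apply: continuous_mulf => //; exact: continuous_cstf.
  - by move=> s /andP[s1 _]; apply: (chirp_dX ch); exact: lt_trans s1.
  - move=> s /andP[s1 _]; have sgt1 : 1 < s by exact: lt_trans s1.
    have s0 : 0 < s by exact: lt_trans sgt1.
    apply: (@locally_eq_is_derive _ (fun y => a2 * ln y) _ _ _ 1 (s + 1)).
    + by rewrite sgt1 ltrDl ltr01.
    + by move=> y /andP[y1 _]; rewrite max_r// ltW.
    + eapply is_derive_eq.
        exact: (is_derive_mulf (is_derive_cstf a2 s) (is_derive1_ln s0)).
      by rewrite mul0r add0r.
  - move=> s /andP[s1 _]; rewrite mulrAC -mulrA; exact: (chirp_dX_le ch (ltW s1)).
rewrite tauE ?ltW// ltr_pdivrMr ?(lt_trans _ T1)//.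
apply: (le_lt_trans H); rewrite /T.
have -> : expR m = expR (a2 * m) * expR ((1 - a2) * m).
  by rewrite -expRD; congr expR; ring.
have h : X S / e < expR ((1 - a2) * m).
  apply: lt_le_trans (expR_ge1Dx _).
  have -> : (1 - a2) * m = X S / e.
    by rewrite /m; field; rewrite !lt0r_neq0.
  by rewrite ltrDr ltr01.
rewrite ltr_pdivrMr// in h.
have -> : e * (S * (expR (a2 * m) * expR ((1 - a2) * m))) =
  S * (expR ((1 - a2) * m) * e) * expR (a2 * m) by ring.
rewrite ltr_pM2r ?expR_gt0//; apply: (lt_le_trans h).
rewrite ler_peMl ?(ltW S1)//.
by rewrite mulr_ge0 ?expR_ge0// ltW.
Qed.

Lemma inversion_decreasing : exists xh : R, 0 < xh /\ x0 <= xh /\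
  forall x y, xh <= x -> x < y -> g y < g x.
Proof.
have S1 := chirp_S ch.
have XS0 := chirp_X_gt0 ch S1.
(* From $X(S)$ on [finv] is at least [S], where $-\tau'=(X/s-X')/s>0$ because $a_2<1$. *)
exists (Num.max x0 (X S)); split; first by rewrite lt_max XS0 orbT.
split; first by rewrite le_max lexx.
move=> x y; rewrite ge_max => /andP[xx Sx] xy.
have [f1 fX] := finvP xx.
have [f1' fX'] := finvP (le_trans xx (ltW xy)).
rewrite -fX -fX' !g_X0 ?fX ?fX'//; last by rewrite (le_trans xx) ?ltW.
apply: tau_decr_chirp.
  by apply: X0_le; rewrite ?(ltW S1)// fX -XE// ltW.
rewrite ltNge; apply/negP => /(chirp_X_ndecr ch f1').
by rewrite !XE// fX fX' leNgt xy.
Qed.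

Section Tail.
Variable xh : R.
Hypothesis xh_gt0 : 0 < xh.
Hypothesis x0xh : x0 <= xh.
Hypothesis g_decr : forall x y, xh <= x -> x < y -> g y < g x.

Let sh := finv xh.

Let sh1 : 1 <= sh. Proof. by have [] := finvP x0xh. Qed.
Let Xsh : X sh = xh. Proof. by rewrite XE//; have [] := finvP x0xh. Qed.

Let tail (s : R) : sh <= s -> [/\ 1 <= s, xh <= X0 s & g (X0 s) = tau s].
Proof.
move=> hs; have s1 := le_trans sh1 hs.
have xs : xh <= X0 s by rewrite -Xsh -XE// (chirp_X_ndecr ch).
by split=> //; apply: g_X0 => //; exact: le_trans xs.
Qed.

Let tau_decr (s t : R) : sh <= s -> s < t -> tau t < tau s.
Proof.
move=> hs st; have [s1 xs <-] := tail hs.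
have [t1 xt <-] := tail (le_trans hs (ltW st)).
by apply: g_decr => //; exact: X0_incr.
Qed.

Let gxh : g xh = tau sh.
Proof. by have [_ _ <-] := tail (lexx sh); rewrite -XE// Xsh. Qed.

Lemma inversion_surjective t : 0 < t <= g xh -> exists x, xh <= x /\ g x = t.
Proof.
move=> /andP[t0 tb]; have [T ST Tt] := tau_vanishes t0.
(* [xh] may lie below $X(S)$ or above it. If [T] were left of [sh], then
   $\tau(sh)<\tau(T)<t\le\tau(sh)$. *)
have shT : sh <= T.
  rewrite leNgt; apply/negP => Tsh.
  have := tau_decr_chirp ST Tsh; rewrite -gxh => h.
  by have := lt_le_trans (lt_trans h Tt) tb; rewrite ltxx.
have [|s] := @IVT R tau sh T t shT (continuous_subspaceT ctau).
  by rewrite ge_min (ltW Tt) orbT le_max -gxh tb.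
rewrite in_itv => /andP[hs _] ts.
by exists (X0 s); have [_ xs gs] := tail hs; rewrite gs.
Qed.

Lemma inversion_asymp (phi : R -> R) :
  (forall t, 0 < t <= g xh -> xh <= phi t /\ g (phi t) = t) ->
  forall W, fundamental_solution (Hmat phi) (g xh) W ->
  asymp_large (fun r => ln (Mmax W (g xh) r)) f /\
  asymp_large
    (fun r => ln (cabs (W (g xh) (Complex 0 r) ord_max ord_max))) f.
Proof.
move=> phiP W fs.
have Xsh0 : 0 < X sh by rewrite Xsh.
apply: (monodromy_asymp ch ctau tauE sh1 Xsh0 tau_decr gxh _ fE fs).
move=> s hs; have [s1 xs gs] := tail hs.
have tb : 0 < tau s <= g xh.
  rewrite (tau_gt0 ch tauE sh1 Xsh0 hs) /= gxh.
  by move: hs; rewrite le_eqVlt => /orP[/eqP->//|hs]; rewrite ltW// tau_decr.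
(* [phi (tau s)] and [X0 s] have the same image under [g], which is injective beyond [xh]. *)
have [xp gp] := phiP _ tb; rewrite XE//.
have [lt|lt|//] := ltgtP (phi (tau s)) (X0 s).
  by have := g_decr xp lt; rewrite gs gp ltxx.
by have := g_decr xs lt; rewrite gs gp ltxx.
Qed.

End Tail.
End Inversion.

Unset Implicit Arguments.
Theorem theorem6p13 (R : realType) (f g : R -> R) (x0 : R) :
  ( (* Case 1 *)
    ((forall x y : R, 1 <= x -> x < y -> f x < f y) /\
     (exists a : R, smoothly_varying f a /\ 1 / 2 < a < 1) /\
     x0 = f 1 /\
     exists finv : R -> R,
       (forall x, f 1 <= x -> 1 <= finv x /\ f (finv x) = x) /\
       (forall x, g x = x / finv x))
  \/
    (* Case 2 *)
    (exists v : R -> R,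
       smoothly_varying v (-1) /\
       (\int[@lebesgue_measure R]_(s in [set s : R | (1 <= s)%R]) (v s)%:E
          = +oo)%E /\
       (forall r, 1 <= r -> f r = Num.sqrt r * int1 v r) /\
       x0 = 1 /\
       exists hinv : R -> R,
         (forall x, 1 <= x ->
            1 <= hinv x /\ int1 (fun s => Num.sqrt s * v s) (hinv x) = x) /\
         (forall x, g x = x / hinv x)) ) ->
  (exists xh : R, 0 < xh /\ x0 <= xh /\
     forall x y, xh <= x -> x < y -> g y < g x) /\
  (forall xh : R, 0 < xh -> x0 <= xh ->
     (forall x y, xh <= x -> x < y -> g y < g x) ->
     let b := g xh in
     (forall t, 0 < t <= b -> exists x, xh <= x /\ g x = t) /\
     (forall phi : R -> R,
        (forall t, 0 < t <= b -> xh <= phi t /\ g (phi t) = t) ->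
        forall W : R -> R[i] -> 'M[R[i]]_2,
          fundamental_solution (Hmat phi) b W ->
          asymp_large (fun r => ln (Mmax W b r)) f /\
          asymp_large
            (fun r => ln (cabs (W b (Complex 0 r) ord_max ord_max))) f)).
Proof.
move=> H.
(* Both cases supply the same data, with [X0] equal to [f] or to [h]. The given inverse is defined
   on a whole half-line, so [X0] is unbounded. *)
have [X0 [finv [dX [V [dV [S [a1 [a2 [c1 [c2 [C [ch fE incr finvP gE]]]]]]]]]]]] :
  exists X0 finv dX V dV S a1 a2 c1 c2 C,
    [/\ chirp (fun s => X0 (Num.max 1 s)) dX V dV S a1 a2 c1 c2 C,
        forall r, S <= r -> f r = Num.sqrt r * V r,
        forall s t : R, 1 <= s -> s < t -> X0 s < X0 t,
        forall x, x0 <= x -> 1 <= finv x /\ X0 (finv x) = x &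
        forall x, g x = x / finv x].
  case: H => [[f_incr [[a [sv ha]] [-> [finv [finvP gE]]]]]|].
    have unb y : exists2 s : R, 1 <= s & y <= f s.
      have mx : f 1 <= Num.max (f 1) y by rewrite le_max lexx.
      have [s1 fs] := finvP _ mx.
      by exists (finv (Num.max (f 1) y)); rewrite // fs le_max lexx orbT.
    have [dX [dV [S [a1 [a2 [c1 [c2 [C [ch fE]]]]]]]]] :=
      chirp_case1 f_incr sv ha unb.
    by exists f, finv, dX,
      (fun s => f (Num.max 1 s) / Num.sqrt (Num.max 1 s)), dV, S, a1, a2, c1, c2, C; split; first exact: ch.
  move=> [v [sv [_ [fE [-> [finv [finvP gE]]]]]]].
  have unb y : exists2 s : R, 1 <= s & y <= int1 (fun s => Num.sqrt s * v s) s.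
    have mx : 1 <= Num.max 1 y by rewrite le_max lexx.
    have [s1 fs] := finvP _ mx.
    by exists (finv (Num.max 1 y)); rewrite // fs le_max lexx orbT.
  have [dX [dV [S [a1 [a2 [c1 [c2 [C ch]]]]]]]] := chirp_case2 sv unb.
  exists (int1 (fun s => Num.sqrt s * v s)), finv, dX,
    (fun s => int1 v (Num.max 1 s)), dV, S, a1, a2, c1, c2, C.
  split; [exact: ch| |exact: (case2_incr sv)|exact: finvP|exact: gE].
  move=> r Sr; have r1 : 1 <= r by rewrite (le_trans _ Sr)// ltW// (chirp_S ch).
  by rewrite fE// max_r.
split; first exact: (inversion_decreasing ch incr finvP gE).
move=> xh xh0 x0xh g_decr b; split.
  by move=> t tb; exact: (inversion_surjective ch incr finvP gE x0xh tb).
move=> phi phiP W fs.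
exact: (inversion_asymp ch fE incr finvP gE xh0 x0xh g_decr phiP fs).
Qed.
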